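(* Let $q\in C^2([0,2\pi])$ be real-valued and let $\widetilde q:\mathbb{R}\to\mathbb{R}$ be given by $\widetilde q(x)=q(x)$ for $0<x<2\pi$, $\widetilde q(x)=q(x+2\pi)$ for $-2\pi<x<0$, and $\widetilde q(x)=0$ for $|x|>2\pi$. Let $F=\begin{pmatrix}f_1\\ f_2\end{pmatrix}\in C_0^\infty((0,2\pi);\mathbb{R}^2)$. Let $u^F$ be the solution of $$u_{tt}-u_{xx}+q(x)u=0,\quad 0<x<2\pi,\ t>0,\qquad u(\cdot,0)=u_t(\cdot,0)=0,$$ $$u(0,t)-u(2\pi,t)=f_1(t),\qquad u_x(0,t)-u_x(2\pi,t)=f_2'(t),$$ and let $v^F$ be the solution of $$v_{tt}-v_{xx}+\widetilde q(x)v=0,\quad x\in\mathbb{R}\setminus\{0\},\ 0<t<2\pi,\qquad v(\cdot,0)=v_t(\cdot,0)=0,$$ $$v(0+,t)-v(0-,t)=f_1(t),\qquad v_x(0+,t)-v_x(0-,t)=f_2'(t).$$ Then for $0<t<2\pi$ $$v^F(x,t)=\begin{cases}u_1^{F_+}(x,t),& 0<x<2\pi,\\ u_1^{F_-}(x+2\pi,t),& -2\pi<x<0,\end{cases}$$ where $u^F=u_1^{F_+}+u_1^{F_-}$ is the decomposition described in the context. Moreover, the response operators coincide: for $0<t<2\pi$, $$\frac12\begin{pmatrix}u^F_x(0,t)+u^F_x(2\pi,t)\\ -u^F(0,t)-u^F(2\pi,t)\end{pmatrix}=\frac12\begin{pmatrix}v^F_x(0+,t)+v^F_x(0-,t)\\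 -v^F(0+,t)-v^F(0-,t)\end{pmatrix}.$$
   Context: Values of $u^F$ and $u^F_x$ at $x=0$ and $x=2\pi$ are one-sided limits from inside $(0,2\pi)$. The left-hand side of the last identity is $(R^{2\pi}F)(t)$, where $R^{2\pi}$ is the response operator of the periodic problem, and the right-hand side is $(\widetilde R^{2\pi}F)(t)$, where $\widetilde R^{2\pi}$ is the response operator of the auxiliary problem on $\mathbb{R}$. Decomposition: for $0<t<2\pi$ and $0<x<2\pi$, $u^F=u_1^{F_+}+u_1^{F_-}$ with $$u_1^{F_+}(x,t)=\tfrac12 f_1(t-x)-\tfrac12 f_2(t-x)+\int_x^t \bigl(w_1^0(x,s)f_1(t-s)+w_2^0(x,s)f_2(t-s)\bigr)\,ds,$$ $$u_1^{F_-}(x,t)=-\tfrac12 f_1(t+x-2\pi)-\tfrac12 f_2(t+x-2\pi)+\int_{2\pi-x}^t \bigl(w_1^{2\pi}(x,s)f_1(t-s)+w_2^{2\pi}(x,s)f_2(t-s)\bigr)\,ds,$$ where $f_1,f_2$ are extended by zero to negative arguments and an integral whose lower limit exceeds its upper limit is $0$. The kernels are independent of $F$ and satisfy, for $j=1,2$ with $\sigma_1=-1$, $\sigma_2=1$: $(w_j^0)_{tt}-(w_j^0)_{xx}+q w_j^0=0$ for $0<x<t<2\pi$; $\frac{d}{dx}w_j^0(x,x)=\sigma_j\frac{q(x)}{4}$ for $0<x<2\pi$; $(w_j^{2\pi})_{tt}-(w_j^{2\pi})_{xx}+q w_j^{2\pi}=0$ for $0<2\pi-x<t<2\pi$; $\frac{d}{dx}w_j^{2\pi}(x,2\pi-x)=-\frac{q(x)}{4}$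 for $0<x<2\pi$; and $w_j^0(0,s)=w_j^{2\pi}(2\pi,s)$, $(w_j^0)_x(0,s)=(w_j^{2\pi})_x(2\pi,s)$ for $0<s<2\pi$. *)

(* Defs.v *)
(* Stdlib real numbers with Coquelicot.  A function of (x, t) is a curried
   [R -> R -> R] with the space variable first. *)
From Stdlib Require Export Reals.
From Coquelicot Require Export Coquelicot.
Open Scope R_scope.

Definition right_lim (g : R -> R) (a : R) : R :=
  iota (fun l : R => filterlim g (at_right a) (locally l)).

Definition left_lim (g : R -> R) (a : R) : R :=
  iota (fun l : R => filterlim g (at_left a) (locally l)).

Definition d_x (u : R -> R -> R) (x t : R) : R := Derive (fun y => u y t) x.
Definition d_t (u : R -> R -> R) (x t : R) : R := Derive (fun s => u x s) t.

Definition wave_eq (q : R -> R) (u : R -> R -> R) (x t : R) : Prop :=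
  d_t (d_t u) x t - d_x (d_x u) x t + q x * u x t = 0.

(* C^2 on a closed set means being the restriction of a C^2 function; at the
   boundary this is the same as one-sided continuity of all derivatives up to
   order 2 for the segments and triangles used below. *)
Definition C2_segment (a b : R) (q : R -> R) : Prop :=
  exists Q : R -> R,
    (forall (k : nat) (x : R), (k <= 2)%nat ->
       ex_derive_n Q k x /\ continuous (Derive_n Q k) x) /\
    (forall x, a <= x <= b -> q x = Q x).

Definition C2_closed (K : R -> R -> Prop) (w : R -> R -> R) : Prop :=
  exists W : R -> R -> R,
    (forall x t, ex_diff_n W 2 x t) /\
    (forall x t, K x t -> w x t = W x t).

(* C_0^infty((0, b)), as functions on the whole line: the support lies in a
   compact subinterval [c, d] of (0, b). *)
Definition test_function (b : R) (f : R -> R) : Prop :=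
  (forall (n : nat) (x : R), ex_derive_n f n x) /\
  exists c d : R, 0 < c /\ d < b /\ forall x, ~ (c <= x <= d) -> f x = 0.

(* [g], restricted to the open set [D], extends continuously to [E], where
   D <= E <= closure of D. *)
Definition extends_to (D E : R -> R -> Prop) (g : R -> R -> R) : Prop :=
  forall x t, E x t ->
    exists l : R,
      filterlim (fun p : R * R => g (fst p) (snd p))
        (within (fun p : R * R => D (fst p) (snd p)) (locally (x, t)))
        (locally l).

(* Classical solutions: C^2 in the open set [D] and C^1 up to the part [E] of
   its closure, so that the boundary and initial traces of u, u_x, u_t make
   sense.  Values of [u] outside [D] play no role. *)
Definition classical_solution
    (D E : R -> R -> Prop) (q : R -> R) (u : R -> R -> R) : Prop :=
  (forall x t, D x t -> ex_diff_n u 2 x t /\ wave_eq q u x t) /\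
  extends_to D E u /\ extends_to D E (d_x u) /\ extends_to D E (d_t u).

Definition zero_initial_data (I : R -> Prop) (u : R -> R -> R) : Prop :=
  forall x, I x ->
    right_lim (fun t => u x t) 0 = 0 /\ right_lim (fun t => d_t u x t) 0 = 0.

Definition periodic_solution
    (q f1 f2 : R -> R) (u : R -> R -> R) : Prop :=
  classical_solution (fun x t => 0 < x < 2 * PI /\ 0 < t)
                     (fun x t => 0 <= x <= 2 * PI /\ 0 <= t) q u /\
  zero_initial_data (fun x => 0 < x < 2 * PI) u /\
  forall t, 0 < t ->
    right_lim (fun x => u x t) 0 - left_lim (fun x => u x t) (2 * PI) = f1 t /\
    right_lim (fun x => d_x u x t) 0 - left_lim (fun x => d_x u x t) (2 * PI)
      = Derive f2 t.

Definition line_solution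
    (qt f1 f2 : R -> R) (v : R -> R -> R) : Prop :=
  classical_solution (fun x t => 0 < x /\ 0 < t < 2 * PI)
                     (fun x t => 0 <= x /\ 0 <= t < 2 * PI) qt v /\
  classical_solution (fun x t => x < 0 /\ 0 < t < 2 * PI)
                     (fun x t => x <= 0 /\ 0 <= t < 2 * PI) qt v /\
  zero_initial_data (fun x => x <> 0) v /\
  forall t, 0 < t < 2 * PI ->
    right_lim (fun x => v x t) 0 - left_lim (fun x => v x t) 0 = f1 t /\
    right_lim (fun x => d_x v x t) 0 - left_lim (fun x => d_x v x t) 0
      = Derive f2 t.

(* The values at 0, 2 * PI and - 2 * PI are left arbitrary. *)
Definition auxiliary_potential (q qt : R -> R) : Prop :=
  (forall x, 0 < x < 2 * PI -> qt x = q x) /\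
  (forall x, - (2 * PI) < x < 0 -> qt x = q (x + 2 * PI)) /\
  (forall x, 2 * PI < Rabs x -> qt x = 0).

(* [RInt a b] is a signed integral when b < a; here it is cut off to 0. *)
Definition RInt_fwd (g : R -> R) (a b : R) : R :=
  if Rle_dec a b then RInt g a b else 0.

Definition u1_plus (w10 w20 : R -> R -> R) (f1 f2 : R -> R) (x t : R) : R :=
  1 / 2 * f1 (t - x) - 1 / 2 * f2 (t - x)
  + RInt_fwd (fun s => w10 x s * f1 (t - s) + w20 x s * f2 (t - s)) x t.

Definition u1_minus (w1p w2p : R -> R -> R) (f1 f2 : R -> R) (x t : R) : R :=
  - (1 / 2) * f1 (t + x - 2 * PI) - 1 / 2 * f2 (t + x - 2 * PI)
  + RInt_fwd (fun s => w1p x s * f1 (t - s) + w2p x s * f2 (t - s))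
      (2 * PI - x) t.

(* [w0] is w_j^0, [wp] is w_j^{2 pi} and [sigma] is sigma_j. *)
Definition kernel_pair
    (q : R -> R) (sigma : R) (w0 wp : R -> R -> R) : Prop :=
  C2_closed (fun x t => 0 <= x <= t /\ t <= 2 * PI) w0 /\
  C2_closed (fun x t => 0 <= 2 * PI - x <= t /\ t <= 2 * PI) wp /\
  (forall x t, 0 < x < t -> t < 2 * PI -> wave_eq q w0 x t) /\
  (forall x, 0 < x < 2 * PI ->
     is_derive (fun y => w0 y y) x (sigma * (q x / 4))) /\
  (forall x t, 0 < 2 * PI - x < t -> t < 2 * PI -> wave_eq q wp x t) /\
  (forall x, 0 < x < 2 * PI ->
     is_derive (fun y => wp y (2 * PI - y)) x (- (q x / 4))) /\
  (forall s, 0 < s < 2 * PI ->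
     w0 0 s = wp (2 * PI) s /\
     right_lim (fun x => d_x w0 x s) 0 = left_lim (fun x => d_x wp x s) (2 * PI)).

(* The decomposition u^F = u_1^{F_+} + u_1^{F_-}, with kernels independent of
   F = (f1, f2). *)
Definition decomposition_kernels
    (q : R -> R) (w10 w20 w1p w2p : R -> R -> R) : Prop :=
  kernel_pair q (-1) w10 w1p /\
  kernel_pair q 1 w20 w2p /\
  forall (f1 f2 : R -> R) (u : R -> R -> R),
    test_function (2 * PI) f1 -> test_function (2 * PI) f2 ->
    periodic_solution q f1 f2 u ->
    forall x t, 0 < x < 2 * PI -> 0 < t < 2 * PI ->
      u x t = u1_plus w10 w20 f1 f2 x t + u1_minus w1p w2p f1 f2 x t.

Definition periodic_response (u : R -> R -> R) (t : R) : R * R :=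
  (1 / 2 * (right_lim (fun x => d_x u x t) 0
            + left_lim (fun x => d_x u x t) (2 * PI)),
   1 / 2 * (- right_lim (fun x => u x t) 0
            - left_lim (fun x => u x t) (2 * PI))).

Definition line_response (v : R -> R -> R) (t : R) : R * R :=
  (1 / 2 * (right_lim (fun x => d_x v x t) 0 + left_lim (fun x => d_x v x t) 0),
   1 / 2 * (- right_lim (fun x => v x t) 0 - left_lim (fun x => v x t) 0)).

(* Main.v *)
Require Import Defs.
From Stdlib Require Import Lra Lia Classical FunctionalExtensionality.
From Stdlib Require Import IndefiniteDescription.

(** The function V that equals [u1_plus] for [x > 0] and the translate of
    [u1_minus] for [x < 0] solves the same transmission problem as [v], and that
    problem has only one solution.

    V solves the wave equation on both sides of the interface.  After the
    reflection [x |-> 2 * PI - x] of the second term, both terms are sums of waves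
    of the form [outgoing], a front [f (t - x)] followed by a [duhamel] integral
    whose kernel solves the wave equation; [outgoing_wave_eq] is the classical
    computation with two integrations by parts.  The test functions vanish near
    0, so an outgoing wave is a C2 function of the whole plane which is 0 for
    [t <= x]; this makes all of its traces plain values, and lets it solve the
    equation with any potential ahead of the front.

    V has the right jumps.  For [t < 2 * PI] the wave sent out by one end of
    the interval has not reached the other end, so [u] and V agree near each end.
    The jump of V at 0 is therefore the difference of the values of [u] at the two
    ends, which the periodic problem prescribes to be that of [v].  The same
    remark yields the equality of the response operators once [v] is known to be V.

    Uniqueness ([transmission_uniqueness]) is proved without energy integrals.
    The difference [z] of two solutions is cut into two waves on the half-line
    [x > 0], one of them reflected.  The derivatives [zt + zx] and [zt - zx] are
    transported along characteristics with source [- p z]; at the interface, the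
    outgoing derivative on one side equals the incoming one on the other.  If these
    derivatives and [z] are bounded by [K exp (lam t)] in a backward triangle, then
    for [lam] large they are bounded by [K / 2 exp (lam t)] there
    ([incoming_estimate], [height_estimate], [outgoing_estimate]), hence vanish. *)

(** * Continuous functions of two variables *)

Definition cont2 (g : R -> R -> R) : Prop := forall x t, continuity_2d_pt g x t.

Lemma cont2_continuous g x t : cont2 g ->
  continuous (fun p : R * R => g (fst p) (snd p)) (x, t).
Proof. intros Hg. exact (proj1 (continuity_2d_pt_filterlim g x t) (Hg x t)). Qed.

Lemma cont2_comp f g h : cont2 f -> cont2 g -> cont2 h ->
  cont2 (fun x t => f (g x t) (h x t)).
Proof.
intros Hf Hg Hh x t. apply continuity_2d_pt_filterlim.
apply (continuous_comp_2 (fun p : R * R => g (fst p) (snd p))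
         (fun p : R * R => h (fst p) (snd p)) f (x, t)).
- now apply cont2_continuous.
- now apply cont2_continuous.
- apply (cont2_continuous f); trivial.
Qed.

Lemma cont2_comp1 (f : R -> R) g : (forall x, continuous f x) -> cont2 g ->
  cont2 (fun x t => f (g x t)).
Proof.
intros Hf Hg x t. apply continuity_1d_2d_pt_comp; auto.
apply continuity_pt_filterlim. apply Hf.
Qed.

Lemma cont2_fst : cont2 (fun x _ => x).
Proof. intros x t. apply continuity_2d_pt_id1. Qed.
Lemma cont2_snd : cont2 (fun _ t => t).
Proof. intros x t. apply continuity_2d_pt_id2. Qed.
Lemma cont2_const c : cont2 (fun _ _ => c).
Proof. intros x t. apply continuity_2d_pt_const. Qed.
Lemma cont2_plus f g : cont2 f -> cont2 g -> cont2 (fun x t => f x t + g x t).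
Proof. intros Hf Hg x t. now apply continuity_2d_pt_plus. Qed.
Lemma cont2_minus f g : cont2 f -> cont2 g -> cont2 (fun x t => f x t - g x t).
Proof. intros Hf Hg x t. now apply continuity_2d_pt_minus. Qed.
Lemma cont2_mult f g : cont2 f -> cont2 g -> cont2 (fun x t => f x t * g x t).
Proof. intros Hf Hg x t. now apply continuity_2d_pt_mult. Qed.
Lemma cont2_opp f : cont2 f -> cont2 (fun x t => - f x t).
Proof. intros Hf x t. now apply continuity_2d_pt_opp. Qed.

Lemma cont2_slice1 g t x : cont2 g -> continuous (fun y => g y t) x.
Proof.
intros Hg. apply (continuous_comp_2 (fun y : R => y) (fun _ : R => t) g x).
- apply continuous_id.
- apply continuous_const.
- now apply cont2_continuous.
Qed.

Lemma cont2_slice2 g x t : cont2 g -> continuous (fun s => g x s) t.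
Proof.
intros Hg. apply (continuous_comp_2 (fun _ : R => x) (fun s : R => s) g t).
- apply continuous_const.
- apply continuous_id.
- now apply cont2_continuous.
Qed.

(** Each point of the segment [0, 1] of integration has a neighbourhood on
    which the integrand moves by less than a given amount; compactness of the
    segment makes the neighbourhood of the parameters uniform. *)
Lemma cont2_RInt (g : R -> R -> R -> R) :
  (forall x t r, continuous (fun p : R * R * R =>
      g (fst (fst p)) (snd (fst p)) (snd p)) ((x, t), r)) ->
  cont2 (fun x t => RInt (g x t) 0 1).
Proof.
intros Hg x t eps.
assert (He : 0 < eps / 2) by (destruct eps; simpl; lra).
assert (Hd : forall r, exists d : posreal, forall x' t' r',
   Rabs (x' - x) < d -> Rabs (t' - t) < d -> Rabs (r' - r) < d ->
   Rabs (g x' t' r' - g x t r) < eps / 2 / 2).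
{ intros r.
  assert (He2 : 0 < eps / 2 / 2) by lra.
  destruct (proj1 (filterlim_locally _ _) (Hg x t r) (mkposreal _ He2)) as [d Hd].
  exists d. intros x' t' r' Hx Ht Hr.
  apply (Hd ((x', t'), r')). repeat split; assumption. }
destruct (functional_choice _ Hd) as [d Hd'].
destruct (compactness_value_1d 0 1 d) as [d0 Hd0].
exists d0. intros x' t' Hx Ht.
assert (Hr : forall r, 0 <= r <= 1 -> Rabs (g x' t' r - g x t r) <= eps / 2).
{ intros r Hr. apply NNPP. intros Hn. apply (Hd0 r Hr).
  intros (r0 & Hr0 & Hrr & Hdd). apply Hn.
  assert (H1 := Hd' r0 x' t' r ltac:(lra) ltac:(lra) Hrr).
  assert (H2 := Hd' r0 x t r
    ltac:(rewrite Rminus_diag, Rabs_R0; apply cond_pos)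
    ltac:(rewrite Rminus_diag, Rabs_R0; apply cond_pos) Hrr).
  apply Rabs_def2 in H1; apply Rabs_def2 in H2; apply Rabs_le; lra. }
assert (Hex : forall x t, ex_RInt (g x t) 0 1).
{ intros y s. apply (@ex_RInt_continuous R_CompleteNormedModule). intros r _.
  apply (continuous_comp (fun r : R => ((y, s), r))
    (fun p : R * R * R => g (fst (fst p)) (snd (fst p)) (snd p))); auto.
  apply (continuous_comp_2 (fun _ : R => (y, s)) (fun r : R => r) pair).
  - apply continuous_const.
  - apply continuous_id.
  - apply filterlim_ext with (fun p : R * R * R => p); [now intros [a b] | apply filterlim_id]. }
change (Rabs (minus (RInt (g x' t') 0 1) (RInt (g x t) 0 1)) < eps).
rewrite <- RInt_minus; trivial.
apply Rle_lt_trans with ((1 - 0) * (eps / 2)); [| lra].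
apply abs_RInt_le_const; [lra | |].
- apply @ex_RInt_minus; trivial.
- intros r Hr'. apply (Hr r Hr').
Qed.

(** * The Duhamel integral *)

(** Here [f] vanishes on the negative half-line in all uses, so that the
    signed integral is automatically 0 for [t <= x] and needs no cut-off.  This
    makes [duhamel K f] a smooth function of the whole plane when [K] and [f]
    are, instead of a function glued along the characteristic [t = x]. *)
Definition duhamel (K : R -> R -> R) (f : R -> R) (x t : R) : R :=
  RInt (fun s => K x s * f (t - s)) x t.

Lemma continuous_sub_l (t s : R) : continuous (fun s : R => t - s) s.
Proof.
apply @continuous_minus; [apply continuous_const | apply continuous_id].
Qed.

Lemma duhamel_integrand_continuous K f x t s : cont2 K -> (forall r, continuous f r) ->
  continuous (fun s => K x s * f (t - s)) s.
Proof.
intros HK Hf.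
apply (continuous_mult (fun s => K x s) (fun s => f (t - s))).
- now apply cont2_slice2.
- apply (continuous_comp (fun s => t - s) f); auto. apply continuous_sub_l.
Qed.

Lemma ex_RInt_duhamel K f x t a b : cont2 K -> (forall r, continuous f r) ->
  ex_RInt (fun s => K x s * f (t - s)) a b.
Proof.
intros HK Hf. apply (@ex_RInt_continuous R_CompleteNormedModule).
intros s _. now apply duhamel_integrand_continuous.
Qed.

(** The substitution [s = x + r (t - x)] moves the dependence on the end points
    into the integrand, where [cont2_RInt] applies. *)
Lemma cont2_duhamel K f : cont2 K -> (forall r, continuous f r) ->
  cont2 (duhamel K f).
Proof.
intros HK Hf.
assert (E : duhamel K f = (fun x t =>
   RInt (fun r => (t - x) * (K x ((t - x) * r + x) * f (t - ((t - x) * r + x)))) 0 1)).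
{ extensionality x. extensionality t. unfold duhamel.
  transitivity (RInt (fun s => K x s * f (t - s)) ((t - x) * 0 + x) ((t - x) * 1 + x)).
  - f_equal; ring.
  - rewrite <- RInt_comp_lin; [reflexivity | now apply ex_RInt_duhamel]. }
rewrite E. apply cont2_RInt. intros x t r.
assert (Cx : continuous (fun p : R * R * R => fst (fst p)) ((x, t), r)).
{ apply (continuous_comp fst fst); apply continuous_fst. }
assert (Ct : continuous (fun p : R * R * R => snd (fst p)) ((x, t), r)).
{ apply (continuous_comp fst snd); [apply continuous_fst | apply continuous_snd]. }
assert (Cr : continuous (fun p : R * R * R => snd p) ((x, t), r)).
{ apply continuous_snd. }
assert (Cd : continuous (fun p : R * R * R => snd (fst p) - fst (fst p)) ((x, t), r)).
{ now apply @continuous_minus. }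
assert (Cs : continuous (fun p : R * R * R =>
   (snd (fst p) - fst (fst p)) * snd p + fst (fst p)) ((x, t), r)).
{ apply @continuous_plus; trivial.
  now apply (continuous_mult (fun p : R * R * R => snd (fst p) - fst (fst p)) snd). }
apply (continuous_mult (fun p : R * R * R => snd (fst p) - fst (fst p))
  (fun p => K (fst (fst p)) ((snd (fst p) - fst (fst p)) * snd p + fst (fst p))
   * f (snd (fst p) - ((snd (fst p) - fst (fst p)) * snd p + fst (fst p))))); trivial.
apply (continuous_mult
  (fun p : R * R * R =>
     K (fst (fst p)) ((snd (fst p) - fst (fst p)) * snd p + fst (fst p)))
  (fun p => f (snd (fst p) - ((snd (fst p) - fst (fst p)) * snd p + fst (fst p))))).
- apply (continuous_comp_2 (fun p : R * R * R => fst (fst p)) _ K); trivial.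
  now apply cont2_continuous.
- apply continuous_comp; auto. now apply @continuous_minus.
Qed.

(** The time derivatives are put on [f]: the kernel is not differentiated in
    time, and the contribution of the end point [s = t] vanishes with [f 0]. *)
Lemma duhamel_derive_t K f df x t : cont2 K ->
  (forall r, is_derive f r (df r)) -> (forall r, continuous df r) -> f 0 = 0 ->
  is_derive (duhamel K f x) t (duhamel K df x t).
Proof.
intros HK Hf Hdf Hf0.
assert (Cf : forall r, continuous f r).
{ intros r. apply (ex_derive_continuous f). eexists; apply Hf. }
assert (HD : forall u s, Derive (fun z => K x s * f (z - s)) u = K x s * df (u - s)).
{ intros u s. apply is_derive_unique.
  replace (K x s * df (u - s)) with (K x s * (1 * df (u - s))) by ring.
  apply is_derive_scal. apply (is_derive_comp f (fun z => z - s)); [apply Hf |].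
  auto_derive; trivial. }
assert (CD : cont2 (fun u s => Derive (fun z => K x s * f (z - s)) u)).
{ intros u s. apply (continuity_2d_pt_ext (fun u s => K x s * df (u - s))).
  - intros; symmetry; apply HD.
  - apply cont2_mult.
    + apply cont2_comp; [trivial | apply cont2_const | apply cont2_snd].
    + apply cont2_comp1; trivial. apply cont2_minus; [apply cont2_fst | apply cont2_snd]. }
evar_last.
{ apply (is_derive_RInt_param_bound_comp (fun u s => K x s * f (u - s)) (fun _ => x) (fun u => u) t 0 1).
  - exists (mkposreal 1 Rlt_0_1). intros u _. now apply ex_RInt_duhamel.
  - exists (mkposreal 1 Rlt_0_1). exists (mkposreal 1 Rlt_0_1). intros u _. now apply ex_RInt_duhamel.
  - exists (mkposreal 1 Rlt_0_1). exists (mkposreal 1 Rlt_0_1). intros u _. now apply ex_RInt_duhamel.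
  - apply @is_derive_const.
  - apply @is_derive_id.
  - exists (mkposreal 1 Rlt_0_1). exists (mkposreal 1 Rlt_0_1). intros u _ s _.
    auto_derive. repeat split. eexists; apply Hf.
  - intros; apply CD.
  - exists (mkposreal 1 Rlt_0_1). intros; apply CD.
  - exists (mkposreal 1 Rlt_0_1). intros; apply CD.
  - apply continuity_pt_filterlim. now apply (duhamel_integrand_continuous K f x t).
  - apply continuity_pt_filterlim. now apply (duhamel_integrand_continuous K f x t). }
unfold duhamel. rewrite Rminus_diag, Hf0.
rewrite (RInt_ext _ (fun s => K x s * df (t - s))); [ring |].
intros s _. apply HD.
Qed.

Lemma duhamel_derive_x K Kx f x t : cont2 K -> cont2 Kx ->
  (forall y s, is_derive (fun z => K z s) y (Kx y s)) ->
  (forall r, continuous f r) ->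
  is_derive (fun y => duhamel K f y t) x (- (K x x * f (t - x)) + duhamel Kx f x t).
Proof.
intros HK HKx HD Cf.
assert (HD' : forall u s, Derive (fun z => K z s * f (t - s)) u = Kx u s * f (t - s)).
{ intros u s. apply is_derive_unique.
  apply (is_derive_scal_l (fun z => K z s) u (Kx u s) (f (t - s))), HD. }
assert (CD : cont2 (fun u s => Derive (fun z => K z s * f (t - s)) u)).
{ intros u s. apply (continuity_2d_pt_ext (fun u s => Kx u s * f (t - s))).
  - intros; symmetry; apply HD'.
  - apply cont2_mult; trivial.
    apply cont2_comp1; trivial. apply cont2_minus; [apply cont2_const | apply cont2_snd]. }
evar_last.
{ apply (is_derive_RInt_param_bound_comp (fun u s => K u s * f (t - s)) (fun u => u) (fun _ => t) x 1 0).
  - exists (mkposreal 1 Rlt_0_1). intros u _. now apply ex_RInt_duhamel.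
  - exists (mkposreal 1 Rlt_0_1). exists (mkposreal 1 Rlt_0_1). intros u _. now apply ex_RInt_duhamel.
  - exists (mkposreal 1 Rlt_0_1). exists (mkposreal 1 Rlt_0_1). intros u _. now apply ex_RInt_duhamel.
  - apply @is_derive_id.
  - apply @is_derive_const.
  - exists (mkposreal 1 Rlt_0_1). exists (mkposreal 1 Rlt_0_1). intros u _ s _.
    apply ex_derive_mult; [eexists; apply HD | apply ex_derive_const].
  - intros; apply CD.
  - exists (mkposreal 1 Rlt_0_1). intros; apply CD.
  - exists (mkposreal 1 Rlt_0_1). intros; apply CD.
  - apply continuity_pt_filterlim. now apply (duhamel_integrand_continuous K f x t).
  - apply continuity_pt_filterlim. now apply (duhamel_integrand_continuous K f x t). }
unfold duhamel.
rewrite (RInt_ext _ (fun s => Kx x s * f (t - s))); [ring |].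
intros s _. apply HD'.
Qed.

(** * Functions of class C2 and their diagonals *)

Lemma is_derive_path g (a b : R -> R) t da db :
  locally_2d (ex_diff_n g 1) (a t) (b t) ->
  is_derive a t da -> is_derive b t db ->
  is_derive (fun s => g (a s) (b s)) t
    (d_x g (a t) (b t) * da + d_t g (a t) (b t) * db).
Proof.
intros Hg Ha Hb.
assert (Hg0 := locally_2d_singleton _ _ _ Hg).
apply is_derive_Reals. apply derivable_pt_lim_comp_2d.
2, 3: now apply is_derive_Reals.
apply filterdiff_differentiable_pt_lim.
apply is_derive_filterdiff.
- apply locally_2d_locally in Hg. revert Hg. apply filter_imp.
  intros [y s] Hys. apply Derive_correct. apply Hys.
- apply Derive_correct. apply Hg0.
- apply (continuity_2d_pt_filterlim (d_x g) (a t) (b t)). apply Hg0.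
Qed.

Lemma is_derive_diagonal g x : (forall x t, ex_diff_n g 1 x t) ->
  is_derive (fun y => g y y) x (d_x g x x + d_t g x x).
Proof.
intros Hg. replace (d_x g x x + d_t g x x) with (d_x g x x * 1 + d_t g x x * 1) by ring.
apply (is_derive_path g (fun y => y) (fun y => y)).
- exists (mkposreal 1 Rlt_0_1). intros; apply Hg.
- apply @is_derive_id.
- apply @is_derive_id.
Qed.

(** Since [ex_diff_n] nests the operator [Derive], exhibiting a function as C2
    requires closed forms for its derivatives as functions, not at a point only;
    the closed forms are returned for later rewriting. *)
Lemma ex_diff_n_2_intro f fx ft fxx fxt ftx ftt :
  (forall x t, is_derive (fun y => f y t) x (fx x t)) ->
  (forall x t, is_derive (fun s => f x s) t (ft x t)) ->
  (forall x t, is_derive (fun y => fx y t) x (fxx x t)) ->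
  (forall x t, is_derive (fun s => fx x s) t (fxt x t)) ->
  (forall x t, is_derive (fun y => ft y t) x (ftx x t)) ->
  (forall x t, is_derive (fun s => ft x s) t (ftt x t)) ->
  cont2 f -> cont2 fx -> cont2 ft -> cont2 fxx -> cont2 fxt -> cont2 ftx -> cont2 ftt ->
  (forall x t, ex_diff_n f 2 x t) /\
  d_x f = fx /\ d_t f = ft /\ d_x (d_x f) = fxx /\ d_t (d_t f) = ftt.
Proof.
intros Hx Ht Hxx Hxt Htx Htt C Cx Ct Cxx Cxt Ctx Ctt.
assert (Ex : d_x f = fx).
{ extensionality x; extensionality t. now apply is_derive_unique. }
assert (Et : d_t f = ft).
{ extensionality x; extensionality t. now apply is_derive_unique. }
assert (Exx : d_x fx = fxx).
{ extensionality x; extensionality t. now apply is_derive_unique. }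
assert (Ext : d_t fx = fxt).
{ extensionality x; extensionality t. now apply is_derive_unique. }
assert (Etx : d_x ft = ftx).
{ extensionality x; extensionality t. now apply is_derive_unique. }
assert (Ett : d_t ft = ftt).
{ extensionality x; extensionality t. now apply is_derive_unique. }
split; [| now rewrite Ex, Et ].
intros x t.
split; [apply C | split; [eexists; apply Hx | split; [eexists; apply Ht |]]].
split.
- change (ex_diff_n (d_x f) 1 x t). rewrite Ex.
  split; [apply Cx | split; [eexists; apply Hxx | split; [eexists; apply Hxt |]]].
  split; split; trivial.
  + change (continuity_2d_pt (d_x fx) x t). now rewrite Exx.
  + change (continuity_2d_pt (d_t fx) x t). now rewrite Ext.
- change (ex_diff_n (d_t f) 1 x t). rewrite Et.
  split; [apply Ct | split; [eexists; apply Htx | split; [eexists; apply Htt |]]].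
  split; split; trivial.
  + change (continuity_2d_pt (d_x ft) x t). now rewrite Etx.
  + change (continuity_2d_pt (d_t ft) x t). now rewrite Ett.
Qed.

Lemma ex_diff_n_2_elim f : (forall x t, ex_diff_n f 2 x t) ->
  ((forall x t, is_derive (fun y => f y t) x (d_x f x t)) /\
   (forall x t, is_derive (fun s => f x s) t (d_t f x t)) /\
   (forall x t, is_derive (fun y => d_x f y t) x (d_x (d_x f) x t)) /\
   (forall x t, is_derive (fun s => d_x f x s) t (d_t (d_x f) x t)) /\
   (forall x t, is_derive (fun y => d_t f y t) x (d_x (d_t f) x t)) /\
   (forall x t, is_derive (fun s => d_t f x s) t (d_t (d_t f) x t))) /\
  cont2 f /\ cont2 (d_x f) /\ cont2 (d_t f) /\ cont2 (d_x (d_x f)) /\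
  cont2 (d_t (d_x f)) /\ cont2 (d_x (d_t f)) /\ cont2 (d_t (d_t f)).
Proof.
intros Hf. repeat match goal with |- _ /\ _ => split end; intros x t; try apply Derive_correct;
  destruct (Hf x t) as (H & Hx & Ht & (Hx' & Hxx & Hxt & (Hxx' & _) & (Hxt' & _)) &
    (Ht' & Htx & Htt & (Htx' & _) & (Htt' & _))); assumption.
Qed.

(** * Test functions *)

Lemma test_function_nonpos b f r : test_function b f -> r <= 0 -> f r = 0.
Proof. intros (_ & c & d & Hc & _ & H) Hr. apply H. lra. Qed.

Lemma test_function_is_derive b f r : test_function b f -> is_derive f r (Derive f r).
Proof. intros (H & _). apply Derive_correct. apply (H 1%nat r). Qed.

Lemma test_function_continuous b f r : test_function b f -> continuous f r.
Proof.
intros Hf. apply (ex_derive_continuous f). eexists. now apply (test_function_is_derive b).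
Qed.

Lemma test_function_Derive b f : test_function b f -> test_function b (Derive f).
Proof.
intros (H & c & d & Hc & Hd & Hs). split.
- intros n x. destruct n as [| n]; [exact I |].
  assert (E : Derive_n (Derive f) n = Derive_n f (S n)).
  { extensionality y. change (Derive f) with (Derive_n f 1).
    rewrite Derive_n_comp. now rewrite Nat.add_1_r. }
  simpl. rewrite E. apply (H (S (S n)) x).
- exists c, d. repeat split; trivial. intros x Hx.
  rewrite (Derive_ext_loc f (fun _ => 0)); [apply Derive_const |].
  destruct (Rlt_dec x c) as [Hlt | Hge].
  + exists (mkposreal (c - x) ltac:(lra)). intros y Hy. apply Hs.
    apply Rabs_def2 in Hy. unfold minus, plus, opp in Hy; simpl in Hy. lra.
  + assert (d < x) by lra.
    exists (mkposreal (x - d) ltac:(lra)). intros y Hy. apply Hs.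
    apply Rabs_def2 in Hy. unfold minus, plus, opp in Hy; simpl in Hy. lra.
Qed.

(** * Outgoing waves *)

(** The wave produced on the half-line [x > 0] by the boundary signal [f]: a
    front travelling at unit speed, followed by the tail that the potential
    creates.  All four pieces of the decomposition have this form, with
    [kappa = sigma_j] on the right of the interface and [kappa = 1] on the left
    of it, after a reflection of the space variable. *)
Definition outgoing (kappa : R) (K : R -> R -> R) (f : R -> R) (x t : R) : R :=
  - (kappa / 2) * f (t - x) + duhamel K f x t.

(** The two conditions under which the front and the tail fit together into a
    solution of the wave equation: the kernel solves the equation behind the
    front and has the prescribed derivative along it. *)
Record outgoing_kernel (p : R -> R) (kappa : R) (K : R -> R -> R) : Prop := {
  outgoing_kernel_C2 : forall x t, ex_diff_n K 2 x t;
  outgoing_kernel_wave : forall x t, 0 < x < t -> t < 2 * PI -> wave_eq p K x t;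
  outgoing_kernel_diagonal : forall x, 0 < x < 2 * PI ->
    is_derive (fun y => K y y) x (kappa * (p x / 4)) }.

Lemma duhamel_zero K f x t : (forall r, r <= 0 -> f r = 0) -> t <= x ->
  duhamel K f x t = 0.
Proof.
intros Hf Htx. unfold duhamel.
rewrite (RInt_ext _ (fun _ => 0)).
- rewrite RInt_const. unfold scal; simpl; unfold mult; simpl; ring.
- intros s Hs. rewrite Rmin_right, Rmax_left in Hs by trivial.
  rewrite Hf by lra. apply Rmult_0_r.
Qed.

Section Outgoing.
Variables (kappa : R) (K : R -> R -> R) (f : R -> R).
Hypothesis HK : forall x t, ex_diff_n K 2 x t.
Hypothesis Hf : test_function (2 * PI) f.

Let f' := Derive f.
Let f'' := Derive f'.

Lemma outgoing_C2 :
  (forall x t, ex_diff_n (outgoing kappa K f) 2 x t) /\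
  d_x (outgoing kappa K f) = (fun x t => kappa / 2 * f' (t - x)
     + (- (K x x * f (t - x)) + duhamel (d_x K) f x t)) /\
  d_t (outgoing kappa K f) = outgoing kappa K f' /\
  d_x (d_x (outgoing kappa K f)) = (fun x t => - (kappa / 2) * f'' (t - x)
     + (- ((d_x K x x + d_t K x x) * f (t - x) - K x x * f' (t - x))
        + (- (d_x K x x * f (t - x)) + duhamel (d_x (d_x K)) f x t))) /\
  d_t (d_t (outgoing kappa K f)) = outgoing kappa K f''.
Proof.
destruct (ex_diff_n_2_elim K HK) as
  ((DKx & DKt & DKxx & DKxt & _ & _) & CK & CKx & CKt & CKxx & CKxt & _ & _).
assert (Hf' : test_function (2 * PI) f') by now apply test_function_Derive.
assert (Hf'' : test_function (2 * PI) f'') by now apply test_function_Derive.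
assert (Df : forall r, is_derive f r (f' r)).
{ intros r. now apply (test_function_is_derive (2 * PI)). }
assert (Df' : forall r, is_derive f' r (f'' r)).
{ intros r. now apply (test_function_is_derive (2 * PI)). }
assert (Cf : forall r, continuous f r).
{ intros r. now apply (test_function_continuous (2 * PI)). }
assert (Cf' : forall r, continuous f' r).
{ intros r. now apply (test_function_continuous (2 * PI)). }
assert (Cf'' : forall r, continuous f'' r).
{ intros r. now apply (test_function_continuous (2 * PI)). }
assert (f0 : f 0 = 0) by (apply (test_function_nonpos (2 * PI)); trivial; lra).
assert (f'0 : f' 0 = 0) by (apply (test_function_nonpos (2 * PI)); trivial; lra).
assert (Sx : forall (g dg : R -> R) (x t : R), (forall r, is_derive g r (dg r)) ->
   is_derive (fun y => g (t - y)) x (- dg (t - x))).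
{ intros g dg x t Hg. replace (- dg (t - x)) with (- 1 * dg (t - x)) by ring.
  apply (is_derive_comp g (fun y => t - y)); [apply Hg | auto_derive; trivial; ring]. }
assert (St : forall (g dg : R -> R) (x t : R), (forall r, is_derive g r (dg r)) ->
   is_derive (fun s => g (s - x)) t (dg (t - x))).
{ intros g dg x t Hg. replace (dg (t - x)) with (1 * dg (t - x)) by ring.
  apply (is_derive_comp g (fun s => s - x)); [apply Hg | auto_derive; trivial; ring]. }
assert (Dk : forall x, is_derive (fun y => K y y) x (d_x K x x + d_t K x x)).
{ intros x. apply is_derive_diagonal. intros y s. apply ex_diff_n_m with 2%nat; auto. }
assert (CS : forall g : R -> R, (forall r, continuous g r) -> cont2 (fun x t => g (t - x))).
{ intros g Hg. apply cont2_comp1; trivial.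
  apply cont2_minus; [apply cont2_snd | apply cont2_fst]. }
assert (CD : forall L, cont2 L -> cont2 (fun x _ => L x x)).
{ intros L HL. now apply cont2_comp; try apply cont2_fst. }
apply (ex_diff_n_2_intro _ _ _ _
  (fun x t => kappa / 2 * f'' (t - x) + (- (K x x * f' (t - x)) + duhamel (d_x K) f' x t))
  (fun x t => kappa / 2 * f'' (t - x) + (- (K x x * f' (t - x)) + duhamel (d_x K) f' x t))).
- intros x t. unfold outgoing.
  replace (kappa / 2 * f' (t - x)) with (- (kappa / 2) * (- f' (t - x))) by ring.
  apply @is_derive_plus; [apply is_derive_scal, Sx, Df |].
  now apply duhamel_derive_x.
- intros x t. unfold outgoing. apply @is_derive_plus; [apply is_derive_scal, St, Df |].
  now apply (duhamel_derive_t K f f').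
- intros x t.
  replace (- (kappa / 2) * f'' (t - x)) with (kappa / 2 * (- f'' (t - x))) by ring.
  apply @is_derive_plus; [apply is_derive_scal, Sx, Df' |].
  apply @is_derive_plus; [| now apply duhamel_derive_x].
  apply @is_derive_opp.
  replace ((d_x K x x + d_t K x x) * f (t - x) - K x x * f' (t - x))
    with ((d_x K x x + d_t K x x) * f (t - x) + K x x * (- f' (t - x))) by ring.
  apply (is_derive_mult (fun y => K y y) (fun y => f (t - y))); [apply Dk | apply Sx, Df |].
  intros; apply Rmult_comm.
- intros x t.
  apply @is_derive_plus; [apply is_derive_scal, St, Df' |].
  apply @is_derive_plus; [| now apply (duhamel_derive_t (d_x K) f f')].
  apply @is_derive_opp. apply is_derive_scal, St, Df.
- intros x t. unfold outgoing.
  replace (kappa / 2 * f'' (t - x)) with (- (kappa / 2) * (- f'' (t - x))) by ring.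
  apply @is_derive_plus; [apply is_derive_scal, Sx, Df' |].
  now apply duhamel_derive_x.
- intros x t. unfold outgoing. apply @is_derive_plus; [apply is_derive_scal, St, Df' |].
  now apply (duhamel_derive_t K f' f'').
all: unfold outgoing; repeat
  (apply cont2_plus || apply cont2_minus || apply cont2_opp || apply cont2_mult);
  auto using cont2_const, cont2_duhamel.
Qed.

Lemma outgoing_rest x t : t <= x ->
  outgoing kappa K f x t = 0 /\ d_t (outgoing kappa K f) x t = 0.
Proof.
destruct outgoing_C2 as (_ & _ & -> & _).
assert (Hf' : test_function (2 * PI) f') by now apply test_function_Derive.
intros Htx. unfold outgoing.
rewrite !duhamel_zero; trivial.
- rewrite (test_function_nonpos (2 * PI) f), (test_function_nonpos (2 * PI) f'); trivial; lra.
- intros r; now apply (test_function_nonpos (2 * PI)).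
- intros r; now apply (test_function_nonpos (2 * PI)).
Qed.

(** Two integrations by parts in [s].  The boundary terms at [s = t] vanish
    because [f] is flat at 0; those at [s = x] survive. *)
Lemma duhamel_two_integrations x t :
  duhamel (d_t (d_t K)) f x t - duhamel K f'' x t
  = - (K x x * f' (t - x) + d_t K x x * f (t - x)).
Proof.
destruct (ex_diff_n_2_elim K HK) as
  ((_ & DKt & _ & _ & _ & DKtt) & CK & _ & _ & _ & _ & _ & CKtt).
assert (Hf' : test_function (2 * PI) f') by now apply test_function_Derive.
assert (Hf'' : test_function (2 * PI) f'') by now apply test_function_Derive.
assert (C : forall r, continuous f r).
{ intros r. now apply (test_function_continuous (2 * PI)). }
assert (C'' : forall r, continuous f'' r).
{ intros r. now apply (test_function_continuous (2 * PI)). }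
assert (f0 : f 0 = 0) by (apply (test_function_nonpos (2 * PI)); trivial; lra).
assert (f'0 : f' 0 = 0) by (apply (test_function_nonpos (2 * PI)); trivial; lra).
assert (Sx : forall (g : R -> R) (s : R), test_function (2 * PI) g ->
   is_derive (fun y => g (t - y)) s (- Derive g (t - s))).
{ intros g s Hg. replace (- Derive g (t - s)) with (- 1 * Derive g (t - s)) by ring.
  apply (is_derive_comp g (fun y => t - y)); [| auto_derive; trivial; ring].
  now apply (test_function_is_derive (2 * PI)). }
unfold duhamel.
assert (E1 := ex_RInt_duhamel (d_t (d_t K)) f x t x t CKtt C).
assert (E2 := ex_RInt_duhamel K f'' x t x t CK C'').
change (minus (RInt (fun s => d_t (d_t K) x s * f (t - s)) x t)
  (RInt (fun s => K x s * f'' (t - s)) x t)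
  = - (K x x * f' (t - x) + d_t K x x * f (t - x))).
rewrite <- RInt_minus by trivial.
apply is_RInt_unique.
replace (- (K x x * f' (t - x) + d_t K x x * f (t - x)))
  with (minus (K x t * f' (t - t) + d_t K x t * f (t - t))
              (K x x * f' (t - x) + d_t K x x * f (t - x)))
  by (unfold minus, plus, opp; simpl; rewrite Rminus_diag, f0, f'0; ring).
apply (is_RInt_derive (fun s => K x s * f' (t - s) + d_t K x s * f (t - s))).
- intros s _. unfold minus, plus, opp; simpl.
  replace (d_t (d_t K) x s * f (t - s) + - (K x s * f'' (t - s)))
    with ((d_t K x s * f' (t - s) + K x s * (- f'' (t - s)))
       + (d_t (d_t K) x s * f (t - s) + d_t K x s * (- f' (t - s)))) by ring.
  apply @is_derive_plus.
  + apply (is_derive_mult (fun s => K x s) (fun s => f' (t - s))); [apply DKt | now apply Sx |].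
    intros; apply Rmult_comm.
  + apply (is_derive_mult (fun s => d_t K x s) (fun s => f (t - s))); [apply DKtt | now apply Sx |].
    intros; apply Rmult_comm.
- intros s _. apply @continuous_minus; now apply (duhamel_integrand_continuous _ _ x t).
Qed.

(** Ahead of the front everything vanishes, so there the equation holds for
    every potential, in particular where the kernel says nothing ([2 * PI <= x]).
    Behind the front, the terms with [f''] and [f'] cancel, the integrals combine
    to the integral of the equation for [K], and the remaining coefficient of
    [f (t - x)] is twice the derivative of [K] along the diagonal minus
    [kappa * p x / 2], which is 0. *)
Lemma outgoing_wave_eq p x t : outgoing_kernel p kappa K -> 0 < x -> t < 2 * PI ->
  wave_eq p (outgoing kappa K f) x t.
Proof.
intros [_ Hw Hk] Hx Ht.
assert (Hf' : test_function (2 * PI) f') by now apply test_function_Derive.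
assert (Hf'' : test_function (2 * PI) f'') by now apply test_function_Derive.
destruct (ex_diff_n_2_elim K HK) as (_ & CK & CKx & CKt & CKxx & _ & _ & CKtt).
assert (C : forall r, continuous f r).
{ intros r. now apply (test_function_continuous (2 * PI)). }
unfold wave_eq. destruct outgoing_C2 as (_ & _ & _ & -> & ->).
destruct (Rle_dec t x) as [Htx | Htx].
- unfold outgoing. rewrite !duhamel_zero; trivial;
    try (intros r; now apply (test_function_nonpos (2 * PI))).
  rewrite (test_function_nonpos (2 * PI) f), (test_function_nonpos (2 * PI) f'),
    (test_function_nonpos (2 * PI) f''); trivial; lra.
- assert (Hd : d_x K x x + d_t K x x = kappa * (p x / 4)).
  { rewrite <- (is_derive_unique _ _ _ (Hk x ltac:(lra))). symmetry.
    apply is_derive_unique, is_derive_diagonal.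
    intros y s. apply ex_diff_n_m with 2%nat; auto. }
  assert (Hi := duhamel_two_integrations x t).
  assert (HI : duhamel (d_t (d_t K)) f x t - duhamel (d_x (d_x K)) f x t
     + p x * duhamel K f x t = 0).
  { unfold duhamel.
    assert (E1 := ex_RInt_duhamel (d_t (d_t K)) f x t x t CKtt C).
    assert (E2 := ex_RInt_duhamel (d_x (d_x K)) f x t x t CKxx C).
    assert (E3 := ex_RInt_duhamel K f x t x t CK C).
    assert (E12 := ex_RInt_minus _ _ _ _ E1 E2).
    assert (E3p := ex_RInt_scal _ _ _ (p x) E3).
    assert (E := RInt_plus _ _ _ _ E12 E3p).
    refine (eq_trans (eq_sym (f_equal2 Rplus (RInt_minus _ _ _ _ E1 E2)
      (RInt_scal _ _ _ (p x) E3))) _).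
    refine (eq_trans (eq_sym E) _).
    rewrite (RInt_ext _ (fun _ => 0)).
    - rewrite RInt_const. unfold scal; simpl; unfold mult; simpl; ring.
    - intros s Hs. rewrite Rmin_left, Rmax_right in Hs by lra.
      unfold plus, minus, opp, scal; simpl; unfold plus, mult; simpl.
      assert (Hws := Hw x s ltac:(lra) ltac:(lra)). unfold wave_eq in Hws.
      transitivity ((d_t (d_t K) x s - d_x (d_x K) x s + p x * K x s) * f (t - s)); [ring |].
      rewrite Hws; apply Rmult_0_l. }
  unfold outgoing.
  assert (Hdf : (d_x K x x + d_t K x x) * f (t - x) = kappa * (p x / 4) * f (t - x))
    by now rewrite Hd.
  lra.
Qed.
End Outgoing.

(** * Waves on a half-strip *)

Definition lim2 (D : R -> R -> Prop) (g : R -> R -> R) (x t l : R) : Prop :=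
  filterlim (fun p : R * R => g (fst p) (snd p))
    (within (fun p : R * R => D (fst p) (snd p)) (locally (x, t))) (locally l).

Definition strip (T x t : R) : Prop := 0 < x /\ 0 < t < T.
Definition strip_closure (T x t : R) : Prop := 0 <= x /\ 0 <= t < T.

(** What uniqueness needs to know about a solution: its two first derivatives,
    and the fact that [zt + zx] and [zt - zx] satisfy ordinary differential
    equations along the characteristics.  In this form, without
    second derivatives, linearity is immediate.  The derivatives are separate
    arguments so that a wave on the negative half-line can be reflected. *)
Record half_wave (T : R) (p : R -> R) (z zx zt : R -> R -> R) : Prop := {
  half_wave_x : forall x t, strip T x t -> is_derive (fun y => z y t) x (zx x t);
  half_wave_t : forall x t, strip T x t -> is_derive (fun s => z x s) t (zt x t);
  half_wave_in : forall c t, strip T (c - t) t ->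
    is_derive (fun s => zt (c - s) s + zx (c - s) s) t (- (p (c - t) * z (c - t) t));
  half_wave_out : forall c t, strip T (c + t) t ->
    is_derive (fun s => zt (c + s) s - zx (c + s) s) t (- (p (c + t) * z (c + t) t));
  half_wave_ext : extends_to (strip T) (strip_closure T) z;
  half_wave_ext_x : extends_to (strip T) (strip_closure T) zx;
  half_wave_ext_t : extends_to (strip T) (strip_closure T) zt }.

Lemma lim2_path {X : Type} (F : (X -> Prop) -> Prop) {FF : Filter F}
  D g x t l (a b : X -> R) :
  lim2 D g x t l -> filterlim a F (locally x) -> filterlim b F (locally t) ->
  F (fun s => D (a s) (b s)) -> filterlim (fun s => g (a s) (b s)) F (locally l).
Proof.
intros Hg Ha Hb HD.
apply (filterlim_comp _ _ _ (fun s => (a s, b s))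
  (fun p : R * R => g (fst p) (snd p)) F _ (locally l)) with (2 := Hg).
intros P [d Hd]. change (F (fun s => P (a s, b s))).
assert (Ha' := proj1 (filterlim_locally _ _) Ha d).
assert (Hb' := proj1 (filterlim_locally _ _) Hb d).
generalize (filter_and _ _ HD (filter_and _ _ Ha' Hb')). apply filter_imp.
intros s (H1 & H2 & H3). now apply Hd.
Qed.

Lemma lim2_plus D f g x t l m : lim2 D f x t l -> lim2 D g x t m ->
  lim2 D (fun x t => f x t + g x t) x t (l + m).
Proof.
intros Hf Hg. unfold lim2 in *.
apply (filterlim_comp_2 _ _ (fun a b : R => a + b) Hf Hg). apply (filterlim_plus l m).
Qed.

Lemma lim2_opp D f x t l : lim2 D f x t l -> lim2 D (fun x t => - f x t) x t (- l).
Proof. intros Hf. apply (filterlim_comp _ _ _ _ _ _ _ _ Hf). apply (filterlim_opp l). Qed.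

Lemma lim2_minus D f g x t l m : lim2 D f x t l -> lim2 D g x t m ->
  lim2 D (fun x t => f x t - g x t) x t (l - m).
Proof. intros Hf Hg. apply lim2_plus; trivial. now apply lim2_opp. Qed.

Lemma extends_to_minus D E f g : extends_to D E f -> extends_to D E g ->
  extends_to D E (fun x t => f x t - g x t).
Proof.
intros Hf Hg x t H. destruct (Hf x t H) as [l Hl], (Hg x t H) as [m Hm].
exists (l - m). now apply lim2_minus.
Qed.

Lemma half_wave_minus T p z zx zt y yx yt :
  half_wave T p z zx zt -> half_wave T p y yx yt ->
  half_wave T p (fun x t => z x t - y x t) (fun x t => zx x t - yx x t)
    (fun x t => zt x t - yt x t).
Proof.
intros [A1 A2 A3 A4 A5 A6 A7] [B1 B2 B3 B4 B5 B6 B7].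
split; try now apply extends_to_minus.
- intros x t H. apply @is_derive_minus; auto.
- intros x t H. apply @is_derive_minus; auto.
- intros c t H.
  apply is_derive_ext with (fun s => (zt (c - s) s + zx (c - s) s) - (yt (c - s) s + yx (c - s) s)).
  { intros s; simpl; ring. }
  replace (- (p (c - t) * (z (c - t) t - y (c - t) t))) with
    ((- (p (c - t) * z (c - t) t)) - (- (p (c - t) * y (c - t) t))) by ring.
  apply @is_derive_minus; auto.
- intros c t H.
  apply is_derive_ext with (fun s => (zt (c + s) s - zx (c + s) s) - (yt (c + s) s - yx (c + s) s)).
  { intros s; simpl; ring. }
  replace (- (p (c + t) * (z (c + t) t - y (c + t) t))) with
    ((- (p (c + t) * z (c + t) t)) - (- (p (c + t) * y (c + t) t))) by ring.
  apply @is_derive_minus; auto.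
Qed.

Lemma filterlim_abs_le {X : Type} (F : (X -> Prop) -> Prop) {FF : ProperFilter' F}
  (g : X -> R) l C : filterlim g F (locally l) -> F (fun s => Rabs (g s) <= C) -> Rabs l <= C.
Proof.
intros Hg HF. apply Rabs_le. split.
- apply (filterlim_le (F := F) (fun _ => - C) g (- C) l); trivial; [| apply filterlim_const].
  generalize HF; apply filter_imp. intros s Hs. apply Rabs_le_between in Hs. lra.
- apply (filterlim_le (F := F) g (fun _ => C) l C); trivial; [| apply filterlim_const].
  generalize HF; apply filter_imp. intros s Hs. apply Rabs_le_between in Hs. lra.
Qed.

Lemma at_right_interval a b : a < b -> at_right a (fun s => a < s < b).
Proof.
intros Hab. exists (mkposreal (b - a) ltac:(lra)). intros s Hs Has.
apply Rabs_def2 in Hs. unfold minus, plus, opp in Hs; simpl in Hs. lra.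
Qed.

(** A function that starts below [C * exp (lam * s)] and grows more slowly stays
    below it.  The starting point is a boundary point, at which only a limit of
    [g] is known. *)
Lemma exp_growth_le lam C (g dg : R -> R) a t l : a < t ->
  (forall s, a < s <= t -> is_derive g s (dg s) /\ dg s <= C * lam * exp (lam * s)) ->
  filterlim g (at_right a) (locally l) -> l <= C * exp (lam * a) ->
  g t <= C * exp (lam * t).
Proof.
intros Hat Hg Hl Hla.
set (h := fun s => g s - C * exp (lam * s)).
assert (Dh : forall s, a < s <= t -> is_derive h s (dg s - C * (lam * exp (lam * s)))).
{ intros s Hs. unfold h. apply @is_derive_minus; [apply Hg; lra |].
  apply is_derive_scal. auto_derive; trivial. ring. }
assert (Hm : forall s, a < s < t -> h t <= h s).
{ intros s Hs.
  destruct (MVT_gen h s t (fun s => dg s - C * (lam * exp (lam * s)))) as (c & Hc & E).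
  - rewrite Rmin_left, Rmax_right by lra. intros c Hc. apply Dh; lra.
  - rewrite Rmin_left, Rmax_right by lra. intros c Hc.
    apply continuity_pt_filterlim, (ex_derive_continuous h).
    eexists; apply Dh; lra.
  - rewrite Rmin_left, Rmax_right in Hc by lra.
    destruct (Hg c ltac:(lra)) as [_ Hdc].
    assert (0 <= (C * lam * exp (lam * c) - dg c) * (t - s)) by (apply Rmult_le_pos; lra).
    nra. }
assert (Lh : filterlim h (at_right a) (locally (l - C * exp (lam * a)))).
{ unfold h. apply (filterlim_comp_2 g (fun s => - (C * exp (lam * s))) (fun u v : R => u + v)
    (G := locally l) (H := locally (- (C * exp (lam * a)))) Hl).
  - assert (Cc : continuous (fun s => - (C * exp (lam * s))) a).
    { apply (ex_derive_continuous (fun s => - (C * exp (lam * s)))). auto_derive; trivial. }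
    apply filterlim_filter_le_1 with (2 := Cc). apply filter_le_within.
  - apply (filterlim_plus l (- (C * exp (lam * a)))). }
assert (H : Rbar_le (h t) (l - C * exp (lam * a))).
{ apply (filterlim_le (F := at_right a) (fun _ => h t) h); trivial.
  - generalize (at_right_interval a t Hat). apply filter_imp. exact Hm.
  - apply filterlim_const. }
unfold h in H; simpl in H. lra.
Qed.

Lemma exp_growth lam C (g dg : R -> R) a t l : a < t ->
  (forall s, a < s <= t -> is_derive g s (dg s) /\ Rabs (dg s) <= C * lam * exp (lam * s)) ->
  filterlim g (at_right a) (locally l) -> Rabs l <= C * exp (lam * a) ->
  Rabs (g t) <= C * exp (lam * t).
Proof.
intros Hat Hg Hl Hla. apply Rabs_le_between in Hla. apply Rabs_le. split.
- enough (- g t <= C * exp (lam * t)) by lra.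
  apply (exp_growth_le lam C (fun s => - g s) (fun s => - dg s) a t (- l)); trivial; [| | lra].
  + intros s Hs. destruct (Hg s Hs) as [H1 H2]. apply Rabs_le_between in H2.
    split; [now apply @is_derive_opp | lra].
  + apply (filterlim_comp _ _ _ _ _ _ _ _ Hl). apply (filterlim_opp l).
- apply (exp_growth_le lam C g dg a t l); trivial; [| lra].
  intros s Hs. destruct (Hg s Hs) as [H1 H2]. apply Rabs_le_between in H2. split; trivial; lra.
Qed.

(** If [h] vanishes on a piece of the boundary, then so does the trace of its
    tangential derivative.  Otherwise, by the mean value theorem, the increment
    of [h] between two points close to the boundary would stay away from 0.  Here
    [s] is the tangential and [n] the normal variable. *)
Lemma tangential_trace (h hs : R -> R -> R) (s0 l : R) :
  filter_prod (locally s0) (at_right 0)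
    (fun p => is_derive (fun s => h s (snd p)) (fst p) (hs (fst p) (snd p))) ->
  locally s0 (fun s => filterlim (h s) (at_right 0) (locally 0)) ->
  filterlim (fun p => hs (fst p) (snd p)) (filter_prod (locally s0) (at_right 0)) (locally l) ->
  l = 0.
Proof.
intros HD H0 Hl. apply NNPP. intros Hl0.
assert (Ha : 0 < Rabs l) by now apply Rabs_pos_lt.
assert (He : 0 < Rabs l / 2) by lra.
assert (Hl' := proj1 (filterlim_locally _ _) Hl (mkposreal _ He)).
destruct (filter_and _ _ HD Hl') as [Q S HQ HS HQS]; simpl in HQS.
destruct (filter_and _ _ HQ H0) as [d Hd].
set (s1 := s0 + d / 2).
assert (Hdp := cond_pos d).
assert (Hball : forall s, s0 <= s <= s1 -> Q s /\ filterlim (h s) (at_right 0) (locally 0)).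
{ intros s Hs. apply Hd. apply Rabs_def1; unfold minus, plus, opp; simpl; unfold s1 in Hs; lra. }
set (e := Rabs l * d / 16).
assert (Hep : 0 < e) by (unfold e; nra).
assert (L0 := proj1 (filterlim_locally (F := at_right 0) (h s0) 0) (proj2 (Hball s0 ltac:(unfold s1; lra))) (mkposreal _ Hep)).
assert (L1 := proj1 (filterlim_locally (F := at_right 0) (h s1) 0) (proj2 (Hball s1 ltac:(unfold s1; lra))) (mkposreal _ Hep)).
destruct (filter_ex (F := at_right 0) _ (filter_and _ _ HS (filter_and _ _ L0 L1)))
  as (n & Hn & Hn0 & Hn1).
assert (DS : forall s, s0 <= s <= s1 -> is_derive (fun s => h s n) s (hs s n) /\
   ball l (Rabs l / 2) (hs s n)).
{ intros s Hs. apply (HQS s n); trivial. now apply Hball. }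
destruct (MVT_gen (fun s => h s n) s0 s1 (fun s => hs s n)) as (c & Hc & E).
- rewrite Rmin_left, Rmax_right by (unfold s1; lra). intros c Hc. apply DS; lra.
- rewrite Rmin_left, Rmax_right by (unfold s1; lra). intros c Hc.
  apply continuity_pt_filterlim, (ex_derive_continuous (fun s => h s n)).
  eexists; apply DS; lra.
- rewrite Rmin_left, Rmax_right in Hc by (unfold s1; lra).
  destruct (DS c Hc) as [_ Hb].
  apply Rabs_def2 in Hb; apply Rabs_def2 in Hn0; apply Rabs_def2 in Hn1.
  unfold minus, plus, opp in Hb, Hn0, Hn1; simpl in Hb, Hn0, Hn1.
  replace (s1 - s0) with (d / 2) in E by (unfold s1; ring).
  unfold e in Hn0, Hn1.
  destruct (Rcase_abs l) as [Hneg | Hpos].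
  + rewrite (Rabs_left l) in * by trivial.
    assert (hs c n < l / 2) by lra. nra.
  + rewrite (Rabs_right l) in * by trivial.
    assert (hs c n > l / 2) by lra. nra.
Qed.

(** The limits at the points of a compact rectangle give local bounds; storing
    each bound in the radius of its neighbourhood (as the inverse of the radius)
    lets the compactness lemma return a uniform bound. *)
Lemma extends_to_bounded T g Rm t0 : extends_to (strip T) (strip_closure T) g -> t0 < T ->
  exists M, 0 <= M /\ forall x t, 0 < x <= Rm -> 0 < t <= t0 -> Rabs (g x t) <= M.
Proof.
intros Hg Ht0.
assert (Hd : forall w : R * R, exists d : posreal, strip_closure T (fst w) (snd w) ->
  forall x t, strip T x t -> Rabs (x - fst w) < d -> Rabs (t - snd w) < d ->
   Rabs (g x t) <= / d).
{ intros [u v]. destruct (classic (strip_closure T u v)) as [Huv | Huv].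
  2: { exists (mkposreal 1 Rlt_0_1). intros H; now elim Huv. }
  destruct (Hg u v Huv) as [l Hl].
  destruct (proj1 (filterlim_locally _ _) Hl (mkposreal 1 Rlt_0_1)) as [d0 Hd0].
  assert (Hlp := Rabs_pos l).
  assert (Hi : 0 < / (1 + Rabs l)) by (apply Rinv_0_lt_compat; lra).
  assert (Hp : 0 < Rmin d0 (/ (1 + Rabs l))) by (apply Rmin_pos; trivial; apply cond_pos).
  exists (mkposreal _ Hp). simpl. intros _ x t Hxt Hx Ht.
  assert (H1 : Rabs (g x t - l) < 1).
  { apply (Hd0 (x, t)); trivial. split.
    - apply Rlt_le_trans with (1 := Hx). apply Rmin_l.
    - apply Rlt_le_trans with (1 := Ht). apply Rmin_l. }
  apply Rle_trans with (1 + Rabs l).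
  - replace (g x t) with ((g x t - l) + l) by ring.
    apply Rle_trans with (1 := Rabs_triang _ _). lra.
  - rewrite <- (Rinv_inv (1 + Rabs l)) at 1. apply Rinv_le_contravar; trivial. apply Rmin_r. }
destruct (functional_choice _ Hd) as [d Hd'].
destruct (compactness_value_2d 0 Rm 0 t0 (fun u v => d (u, v))) as [d0 Hd0].
exists (/ d0). assert (Hdp := cond_pos d0).
split; [left; now apply Rinv_0_lt_compat |].
intros x t Hx Ht. apply NNPP. intros Hn.
apply (Hd0 x t); [lra | lra |]. intros (u & v & Hu & Hv & Hxu & Htv & Hdd). apply Hn.
apply Rle_trans with (/ d (u, v)).
- apply (Hd' (u, v)); trivial; unfold strip, strip_closure; simpl; lra.
- now apply Rinv_le_contravar.
Qed.

(** * Halving the bounds along characteristics *)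

Lemma at_right_continuous (f : R -> R) a l : continuous f a -> f a = l ->
  filterlim f (at_right a) (locally l).
Proof.
intros Hf <-. apply filterlim_filter_le_1 with (2 := Hf). apply filter_le_within.
Qed.

Lemma at_left_continuous (f : R -> R) a l : continuous f a -> f a = l ->
  filterlim f (at_left a) (locally l).
Proof.
intros Hf <-. apply filterlim_filter_le_1 with (2 := Hf). apply filter_le_within.
Qed.

(** A wave and its two characteristic derivatives are supposed to be bounded by
    [K * exp (lam * t)] in the triangle [in_cone].  Integrating along
    characteristics and along vertical lines, none of which leaves the triangle
    backwards in time, improves the bound to [K / 2 * exp (lam * t)]: the
    integral of the exponential yields a factor [1 / lam], and [lam] is chosen so
    that [lam / 2] is at least 1 and at least the bound [Q] of the potential. *)
Section Estimates.
Variables (T Q Rm t0 K : R).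
Hypotheses (HQ : 0 <= Q) (HT : t0 < T) (HK : 0 <= K).
Let lam := 2 * (Q + 1).

Definition zero_data (z zx zt : R -> R -> R) : Prop :=
  forall x, 0 < x -> lim2 (strip T) z x 0 0 /\ lim2 (strip T) zx x 0 0 /\
    lim2 (strip T) zt x 0 0.

Definition in_cone (x t : R) : Prop := 0 < x /\ 0 < t <= t0 /\ x + t <= Rm.

Definition cone_bound (C : R) (g : R -> R -> R) : Prop :=
  forall x t, in_cone x t -> Rabs (g x t) <= C * exp (lam * t).

Definition cone_bounds (C : R) (z zx zt : R -> R -> R) : Prop :=
  cone_bound C z /\ cone_bound C (fun x t => zt x t + zx x t) /\
  cone_bound C (fun x t => zt x t - zx x t).

Variables (p : R -> R) (z zx zt : R -> R -> R).
Hypothesis Hp : forall x, 0 < x -> Rabs (p x) <= Q.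
Hypothesis Hz : half_wave T p z zx zt.
Hypothesis H0 : zero_data z zx zt.
Hypothesis HB : cone_bounds K z zx zt.

Lemma cone_source x t : in_cone x t ->
  Rabs (- (p x * z x t)) <= K / 2 * lam * exp (lam * t).
Proof.
intros H. rewrite Rabs_Ropp, Rabs_mult.
destruct HB as [Hb _]. specialize (Hb x t H).
assert (Hpx := Hp x (proj1 H)).
apply Rle_trans with (Q * (K * exp (lam * t))).
- apply Rmult_le_compat; trivial; apply Rabs_pos.
- assert (0 <= K * exp (lam * t)).
  { apply Rmult_le_pos; trivial. left; apply exp_pos. }
  replace (K / 2 * lam) with (K * Q + K) by (unfold lam; field). lra.
Qed.

Lemma exp_bound_pos t : 0 <= K / 2 * exp (lam * t).
Proof. apply Rmult_le_pos; [lra | left; apply exp_pos]. Qed.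

Lemma at_right_id (a : R) : filterlim (fun s : R => s) (at_right a) (locally a).
Proof. apply at_right_continuous; trivial. apply continuous_id. Qed.

Lemma at_right_affine (c k a b : R) : c + k * a = b ->
  filterlim (fun s : R => c + k * s) (at_right a) (locally b).
Proof.
intros E. apply at_right_continuous; trivial.
apply (ex_derive_continuous (fun s => c + k * s)). auto_derive; trivial.
Qed.

(** The characteristics of [zt + zx] move towards [x = 0], so backwards in time
    they end at the initial line without meeting the interface. *)
Lemma incoming_estimate : cone_bound (K / 2) (fun x t => zt x t + zx x t).
Proof.
intros x t (Hx & Ht & Hxt).
replace (zt x t + zx x t) with (zt (x + t - t) t + zx (x + t - t) t)
  by now replace (x + t - t) with x by ring.
apply (exp_growth lam (K / 2) (fun s => zt (x + t - s) s + zx (x + t - s) s)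
  (fun s => - (p (x + t - s) * z (x + t - s) s)) 0 t 0); [lra | | |].
- intros s Hs. split.
  + apply (half_wave_in _ _ _ _ _ Hz). unfold strip; lra.
  + apply cone_source. unfold in_cone; lra.
- destruct (H0 (x + t)) as (_ & Lx & Lt); [lra |].
  apply (lim2_path (at_right 0) (strip T) (fun x t => zt x t + zx x t) (x + t) 0 0
    (fun s => x + t - s) (fun s => s)).
  + replace 0 with (0 + 0) at 2 by ring. now apply lim2_plus.
  + apply filterlim_ext with (fun s => x + t + -1 * s); [intros; ring |].
    apply at_right_affine; ring.
  + apply at_right_id.
  + generalize (at_right_interval 0 t ltac:(lra)). apply filter_imp.
    intros s Hs. unfold strip; lra.
- rewrite Rabs_R0. apply exp_bound_pos.
Qed.

Lemma height_estimate : cone_bound (K / 2) z.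
Proof.
intros x t (Hx & Ht & Hxt).
apply (exp_growth lam (K / 2) (z x) (zt x) 0 t 0); [lra | | |].
- intros s Hs. split.
  + apply (half_wave_t _ _ _ _ _ Hz). unfold strip; lra.
  + destruct HB as (_ & Ha & Hb).
    assert (Hc : in_cone x s) by (unfold in_cone; lra).
    specialize (Ha x s Hc); specialize (Hb x s Hc).
    assert (HKe : 0 <= K * exp (lam * s) * Q).
    { apply Rmult_le_pos; trivial. apply Rmult_le_pos; trivial. left; apply exp_pos. }
    replace (K / 2 * lam * exp (lam * s))
      with (K * exp (lam * s) * Q + K * exp (lam * s)) by (unfold lam; field).
    apply Rabs_le_between in Ha; apply Rabs_le_between in Hb. apply Rabs_le. lra.
- destruct (H0 x Hx) as (L & _).
  apply (lim2_path (at_right 0) (strip T) z x 0 0 (fun _ => x) (fun s => s)); trivial.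
  + apply filterlim_const.
  + apply at_right_id.
  + generalize (at_right_interval 0 t ltac:(lra)). apply filter_imp.
    intros s Hs. unfold strip; lra.
- rewrite Rabs_R0. apply exp_bound_pos.
Qed.

Variables (yx yt : R -> R -> R).
Hypothesis Hcouple : forall t, 0 < t < T -> exists l,
  lim2 (strip T) (fun x t => zt x t - zx x t) 0 t l /\
  lim2 (strip T) (fun x t => yt x t + yx x t) 0 t l.
Hypothesis Hy : cone_bound (K / 2) (fun x t => yt x t + yx x t).

(** The characteristics of [zt - zx] that come from the interface start there
    with the value of the incoming derivative of the wave on the other side. *)
Lemma outgoing_estimate : cone_bound (K / 2) (fun x t => zt x t - zx x t).
Proof.
assert (Hgen : forall x t a l, in_cone x t -> 0 <= a < t -> t - a <= x ->
   lim2 (strip T) (fun x t => zt x t - zx x t) (x - t + a) a l ->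
   Rabs l <= K / 2 * exp (lam * a) ->
   Rabs (zt x t - zx x t) <= K / 2 * exp (lam * t)).
{ intros x t a l (Hx & Ht & Hxt) Ha Hax Ll Hl.
  replace (zt x t - zx x t) with (zt (x - t + t) t - zx (x - t + t) t)
    by now replace (x - t + t) with x by ring.
  apply (exp_growth lam (K / 2) (fun s => zt (x - t + s) s - zx (x - t + s) s)
    (fun s => - (p (x - t + s) * z (x - t + s) s)) a t l); [lra | | | trivial].
  - intros s Hs. split.
    + apply (half_wave_out _ _ _ _ _ Hz). unfold strip; lra.
    + apply cone_source. unfold in_cone; lra.
  - apply (lim2_path (at_right a) (strip T) (fun x t => zt x t - zx x t) (x - t + a) a l
      (fun s => x - t + s) (fun s => s)); trivial.
    + apply filterlim_ext with (fun s => x - t + 1 * s); [intros; ring |].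
      apply at_right_affine; ring.
    + apply at_right_id.
    + generalize (at_right_interval a t ltac:(lra)). apply filter_imp.
      intros s Hs. unfold strip; lra. }
assert (Hne : forall x t, in_cone x t -> x <> t ->
   Rabs (zt x t - zx x t) <= K / 2 * exp (lam * t)).
{ intros x t Hc Hne. destruct (Rlt_dec x t) as [Hlt | Hge].
  - destruct Hc as (Hx & Ht & Hxt).
    destruct (Hcouple (t - x)) as (l & Lz & Ly); [lra |].
    apply (Hgen x t (t - x) l); try (unfold in_cone; lra).
    + now replace (x - t + (t - x)) with 0 by ring.
    + apply (filterlim_abs_le (at_right 0) (fun s => yt s (t - x) + yx s (t - x)) l).
      * apply (lim2_path (at_right 0) (strip T) (fun x t => yt x t + yx x t) 0 (t - x) l
          (fun s => s) (fun _ => t - x)); trivial.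
        -- apply at_right_id.
        -- apply filterlim_const.
        -- generalize (at_right_interval 0 x Hx). apply filter_imp.
           intros s Hs. unfold strip; lra.
      * generalize (at_right_interval 0 x Hx). apply filter_imp.
        intros s Hs. apply Hy. unfold in_cone; lra.
  - assert (Hc' := Hc). destruct Hc' as (Hx & Ht & Hxt).
    destruct (H0 (x - t)) as (_ & Lx & Lt); [lra |].
    apply (Hgen x t 0 0); try lra; trivial.
    + rewrite Rplus_0_r. replace 0 with (0 - 0) at 2 by ring. now apply lim2_minus.
    + rewrite Rabs_R0. apply exp_bound_pos. }
(* On the characteristic through the corner (0, 0), where no trace is
   prescribed, the bound follows by continuity from the points to the left. *)
intros x t Hc. destruct (Req_dec x t) as [E | Hxt]; [| now apply Hne].
destruct Hc as (Hx & Ht & Hxt).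
assert (Ce : forall g, extends_to (strip T) (strip_closure T) g ->
   filterlim (fun y => g y t) (at_left x) (locally (g x t))).
{ intros g Hg. destruct (Hg x t) as [m Hm]; [unfold strip_closure; lra |].
  assert (E' : g x t = m).
  { apply (filterlim_locally_unique (F := at_right 0) (fun _ => g x t)).
    - apply filterlim_const.
    - apply (lim2_path (at_right 0) (strip T) g x t m (fun _ => x) (fun _ => t) Hm).
      + apply filterlim_const.
      + apply filterlim_const.
      + apply filter_forall. unfold strip; intros _; lra. }
  rewrite E' at 1.
  apply (lim2_path (at_left x) (strip T) g x t m (fun y => y) (fun _ => t)); trivial.
  - apply at_left_continuous; trivial. apply continuous_id.
  - apply filterlim_const.
  - exists (mkposreal x Hx). intros y Hb Hyx. apply Rabs_def2 in Hb.
    unfold minus, plus, opp in Hb; simpl in Hb. unfold strip; lra. }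
apply (filterlim_abs_le (at_left x) (fun y => zt y t - zx y t)).
- apply (filterlim_comp_2 _ _ (fun a b : R => a + b) (Ce zt (half_wave_ext_t _ _ _ _ _ Hz))
    (filterlim_comp _ _ _ _ _ _ _ _ (Ce zx (half_wave_ext_x _ _ _ _ _ Hz)) (filterlim_opp (zx x t)))).
  apply (filterlim_plus (zt x t) (- zx x t)).
- exists (mkposreal x Hx). intros y Hb Hyx. apply Rabs_def2 in Hb.
  unfold minus, plus, opp in Hb; simpl in Hb.
  apply Hne; [unfold in_cone; lra | lra].
Qed.
End Estimates.

(** * Uniqueness for the transmission problem *)

(** The solution is bounded on the triangle with vertex [(x, t)], by compactness;
    the three estimates then halve the bound for ever. *)
Lemma coupled_half_waves_vanish T Q p1 p2 z zx zt y yx yt : 0 <= Q ->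
  (forall x, 0 < x -> Rabs (p1 x) <= Q) -> (forall x, 0 < x -> Rabs (p2 x) <= Q) ->
  half_wave T p1 z zx zt -> half_wave T p2 y yx yt ->
  zero_data T z zx zt -> zero_data T y yx yt ->
  (forall t, 0 < t < T -> exists l,
     lim2 (strip T) (fun x t => zt x t - zx x t) 0 t l /\
     lim2 (strip T) (fun x t => yt x t + yx x t) 0 t l) ->
  (forall t, 0 < t < T -> exists l,
     lim2 (strip T) (fun x t => yt x t - yx x t) 0 t l /\
     lim2 (strip T) (fun x t => zt x t + zx x t) 0 t l) ->
  forall x t, strip T x t -> z x t = 0 /\ y x t = 0.
Proof.
intros HQ Hp1 Hp2 Hz Hy Iz Iy Czy Cyz x t Hxt.
set (lam := 2 * (Q + 1)).
assert (HT : t < T) by apply Hxt.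
assert (Hstart : forall p g gx gt, half_wave T p g gx gt ->
   exists K, 0 <= K /\ forall C, K <= C -> cone_bounds Q (x + t) t C g gx gt).
{ intros p g gx gt [_ _ _ _ E Ex Et].
  destruct (extends_to_bounded T g (x + t) t E HT) as (M & HM & BM).
  destruct (extends_to_bounded T gx (x + t) t Ex HT) as (Mx & HMx & BMx).
  destruct (extends_to_bounded T gt (x + t) t Et HT) as (Mt & HMt & BMt).
  exists (M + Mx + Mt). split; [lra |]. intros C HC.
  assert (Hexp : forall s, 0 < s -> C <= C * exp (2 * (Q + 1) * s)).
  { intros s Hs. rewrite <- (Rmult_1_r C) at 1. apply Rmult_le_compat_l; [lra |].
    rewrite <- exp_0 at 1. apply Rlt_le, exp_increasing. apply Rmult_lt_0_compat; lra. }
  repeat split; intros r s (Hr & Hs & Hrs); apply Rle_trans with C; try (apply Hexp; lra).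
  - apply Rle_trans with M; [apply BM; lra | lra].
  - apply Rle_trans with (1 := Rabs_triang _ _).
    assert (H1 := BMt r s ltac:(lra) ltac:(lra)).
    assert (H2 := BMx r s ltac:(lra) ltac:(lra)). lra.
  - unfold Rminus. apply Rle_trans with (1 := Rabs_triang _ _). rewrite Rabs_Ropp.
    assert (H1 := BMt r s ltac:(lra) ltac:(lra)).
    assert (H2 := BMx r s ltac:(lra) ltac:(lra)). lra. }
destruct (Hstart _ _ _ _ Hz) as (Kz & HKz & Bz).
destruct (Hstart _ _ _ _ Hy) as (Ky & HKy & By).
set (K := Kz + Ky).
assert (Hn : forall n, cone_bounds Q (x + t) t (K * (/ 2) ^ n) z zx zt /\
                       cone_bounds Q (x + t) t (K * (/ 2) ^ n) y yx yt).
{ induction n as [| n [IHz IHy]].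
  - simpl. rewrite Rmult_1_r. split; [apply Bz | apply By]; unfold K; lra.
  - assert (HKn : 0 <= K * (/ 2) ^ n).
    { apply Rmult_le_pos; [unfold K; lra | apply pow_le; lra]. }
    replace (K * (/ 2) ^ S n) with (K * (/ 2) ^ n / 2) by (simpl; field).
    assert (Az := incoming_estimate _ _ _ _ _ HT HKn _ _ _ _ Hp1 Hz Iz IHz).
    assert (Ay := incoming_estimate _ _ _ _ _ HT HKn _ _ _ _ Hp2 Hy Iy IHy).
    split; (split; [| split]); trivial.
    + now apply (height_estimate T _ _ _ _ HQ HT HKn p1 z zx zt).
    + now apply (outgoing_estimate T _ _ _ _ HT HKn p1 z zx zt Hp1 Hz Iz IHz yx yt).
    + now apply (height_estimate T _ _ _ _ HQ HT HKn p2 y yx yt).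
    + now apply (outgoing_estimate T _ _ _ _ HT HKn p2 y yx yt Hp2 Hy Iy IHy zx zt). }
assert (Hc : in_cone (x + t) t x t) by (unfold in_cone, strip in *; lra).
assert (Hlim : forall r, (forall n, Rabs r <= K * (/ 2) ^ n * exp (lam * t)) -> r = 0).
{ intros r Hr.
  assert (L : is_lim_seq (fun n => K * (/ 2) ^ n * exp (lam * t)) 0).
  { replace (Finite 0) with (Rbar_mult (Rbar_mult K 0) (exp (lam * t)))
      by (simpl; f_equal; ring).
    apply is_lim_seq_scal_r, is_lim_seq_scal_l, is_lim_seq_geom.
    rewrite Rabs_right; lra. }
  assert (H := is_lim_seq_le (fun _ => Rabs r) _ (Rabs r) 0 Hr (is_lim_seq_const _) L).
  simpl in H. destruct (Req_dec r 0) as [| Hr0]; trivial.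
  assert (H' := Rabs_pos_lt r Hr0). lra. }
split; apply Hlim; intros n; destruct (Hn n) as [[H1 _] [H2 _]];
  [now apply H1 | now apply H2].
Qed.

(** A limit that exists in the half-strip can be computed along any path. *)
Lemma extends_to_limit T g x t l (a b : R -> R) :
  extends_to (strip T) (strip_closure T) g -> strip_closure T x t ->
  filterlim a (at_right 0) (locally x) -> filterlim b (at_right 0) (locally t) ->
  at_right 0 (fun s => strip T (a s) (b s)) ->
  filterlim (fun s => g (a s) (b s)) (at_right 0) (locally l) ->
  lim2 (strip T) g x t l.
Proof.
intros Hg Hxt Ha Hb HD Hl. destruct (Hg x t Hxt) as [m Hm].
replace l with m; trivial.
apply (filterlim_locally_unique (F := at_right 0) (fun s => g (a s) (b s))); trivial.
now apply (lim2_path (at_right 0) (strip T) g x t m).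
Qed.

Lemma filter_prod_near (s0 : R) (P : R -> R -> Prop) d : 0 < d ->
  (forall s n, Rabs (s - s0) < d -> 0 < n < d -> P s n) ->
  filter_prod (locally s0) (at_right 0) (fun p => P (fst p) (snd p)).
Proof.
intros Hd HP. apply (Filter_prod _ _ _ (fun s => Rabs (s - s0) < d) (fun n => 0 < n < d)).
- exists (mkposreal d Hd). intros s Hs. exact Hs.
- now apply at_right_interval.
- intros s n Hs Hn. now apply HP.
Qed.

Lemma filterlim_snd_at_right (s0 : R) :
  filterlim snd (filter_prod (locally s0) (at_right 0)) (locally 0).
Proof.
apply (filterlim_filter_le_2 (G := at_right 0) (@snd R R)).
- apply filter_le_within.
- apply filterlim_snd.
Qed.

(** The trace of [zx] vanishes with that of [z], being a tangential derivative;
    the other two traces are given. *)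
Lemma zero_data_of_initial T p z zx zt : 0 < T -> half_wave T p z zx zt ->
  (forall x, 0 < x -> filterlim (z x) (at_right 0) (locally 0)) ->
  (forall x, 0 < x -> filterlim (zt x) (at_right 0) (locally 0)) ->
  zero_data T z zx zt.
Proof.
intros HT [Hx _ _ _ E Ex Et] I It x Hxp.
assert (Hc : strip_closure T x 0) by (unfold strip_closure; lra).
assert (HD : at_right 0 (fun s => strip T x s)).
{ generalize (at_right_interval 0 T HT). apply filter_imp. unfold strip; intros; lra. }
split; [| split].
- apply (extends_to_limit T z x 0 0 (fun _ => x) (fun s => s)); auto.
  apply filterlim_const. apply at_right_id.
- destruct (Ex x 0 Hc) as [l Hl]. enough (El : l = 0) by now rewrite El in Hl.
  assert (Hd : 0 < Rmin x T) by now apply Rmin_pos.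
  apply (tangential_trace z zx x).
  + apply (filter_prod_near x (fun s n => is_derive (fun s => z s n) s (zx s n)) (Rmin x T)); trivial.
    intros s n Hs Hn. apply Hx. apply Rabs_def2 in Hs.
    assert (H1 := Rmin_l x T); assert (H2 := Rmin_r x T). unfold strip; lra.
  + exists (mkposreal x Hxp). intros s Hs. apply I. apply Rabs_def2 in Hs.
    unfold minus, plus, opp in Hs; simpl in Hs. lra.
  + apply (lim2_path (filter_prod (locally x) (at_right 0)) (strip T) zx x 0 l fst snd); trivial.
    * apply filterlim_fst.
    * apply filterlim_snd_at_right.
    * apply (filter_prod_near x (strip T) (Rmin x T)); trivial.
      intros s n Hs Hn. apply Rabs_def2 in Hs.
      assert (H1 := Rmin_l x T); assert (H2 := Rmin_r x T). unfold strip; lra.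
- apply (extends_to_limit T zt x 0 0 (fun _ => x) (fun s => s)); auto.
  apply filterlim_const. apply at_right_id.
Qed.

(** Continuity of the height across the interface gives that of the time
    derivative, again a tangential derivative.  With the continuity of the slope,
    what leaves the interface on one side is what arrives on the other; the sign
    in the second condition comes from the reflection of [y]. *)
Lemma interface_coupling T p1 p2 z zx zt y yx yt :
  half_wave T p1 z zx zt -> half_wave T p2 y yx yt ->
  (forall t, 0 < t < T -> filterlim (fun x => z x t - y x t) (at_right 0) (locally 0)) ->
  (forall t, 0 < t < T -> filterlim (fun x => zx x t + yx x t) (at_right 0) (locally 0)) ->
  forall t, 0 < t < T -> exists l,
     lim2 (strip T) (fun x t => zt x t - zx x t) 0 t l /\
     lim2 (strip T) (fun x t => yt x t + yx x t) 0 t l.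
Proof.
intros [_ Hzt _ _ _ Ezx Ezt] [_ Hyt _ _ _ Eyx Eyt] J Jx t Ht.
assert (Hc : strip_closure T 0 t) by (unfold strip_closure; lra).
destruct (Ezx 0 t Hc) as [b Hb], (Ezt 0 t Hc) as [a Ha],
  (Eyx 0 t Hc) as [d Hd], (Eyt 0 t Hc) as [c Hc'].
set (r := Rmin t (T - t)).
assert (Hr : 0 < r) by (apply Rmin_pos; lra).
assert (Hr1 := Rmin_l t (T - t)); assert (Hr2 := Rmin_r t (T - t)); fold r in Hr1, Hr2.
assert (Hac : a - c = 0).
{ apply (tangential_trace (fun s n => z n s - y n s) (fun s n => zt n s - yt n s) t).
  - apply (filter_prod_near t (fun s n => is_derive (fun s => z n s - y n s) s (zt n s - yt n s)) r);
      trivial.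
    intros s n Hs Hn. apply Rabs_def2 in Hs. apply @is_derive_minus;
      [apply Hzt | apply Hyt]; unfold strip; lra.
  - exists (mkposreal r Hr). intros s Hs. apply J. apply Rabs_def2 in Hs.
    unfold minus, plus, opp in Hs; simpl in Hs. lra.
  - apply (lim2_path (filter_prod (locally t) (at_right 0)) (strip T)
      (fun x t => zt x t - yt x t) 0 t (a - c) snd fst).
    + now apply lim2_minus.
    + apply filterlim_snd_at_right.
    + apply filterlim_fst.
    + apply (filter_prod_near t (fun s n => strip T n s) r); trivial.
      intros s n Hs Hn. apply Rabs_def2 in Hs. unfold strip; lra. }
assert (Hbd : b + d = 0).
{ apply (filterlim_locally_unique (F := at_right 0) (fun x => zx x t + yx x t)); auto.
  apply (lim2_path (at_right 0) (strip T) (fun x t => zx x t + yx x t) 0 t (b + d)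
    (fun x => x) (fun _ => t)).
  - now apply lim2_plus.
  - apply at_right_id.
  - apply filterlim_const.
  - generalize (at_right_interval 0 1 Rlt_0_1). apply filter_imp. unfold strip; intros; lra. }
exists (a - b). split; [now apply lim2_minus |].
replace (a - b) with (c + d) by lra. now apply lim2_plus.
Qed.

Lemma transmission_uniqueness T Q p1 p2 z zx zt y yx yt : 0 <= Q -> 0 < T ->
  (forall x, 0 < x -> Rabs (p1 x) <= Q) -> (forall x, 0 < x -> Rabs (p2 x) <= Q) ->
  half_wave T p1 z zx zt -> half_wave T p2 y yx yt ->
  (forall x, 0 < x -> filterlim (z x) (at_right 0) (locally 0)) ->
  (forall x, 0 < x -> filterlim (zt x) (at_right 0) (locally 0)) ->
  (forall x, 0 < x -> filterlim (y x) (at_right 0) (locally 0)) ->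
  (forall x, 0 < x -> filterlim (yt x) (at_right 0) (locally 0)) ->
  (forall t, 0 < t < T -> filterlim (fun x => z x t - y x t) (at_right 0) (locally 0)) ->
  (forall t, 0 < t < T -> filterlim (fun x => zx x t + yx x t) (at_right 0) (locally 0)) ->
  forall x t, strip T x t -> z x t = 0 /\ y x t = 0.
Proof.
intros HQ HT Hp1 Hp2 Hz Hy Iz Izt Iy Iyt J Jx.
apply (coupled_half_waves_vanish T Q p1 p2 z zx zt y yx yt); trivial.
- now apply (zero_data_of_initial T p1).
- now apply (zero_data_of_initial T p2).
- now apply (interface_coupling T p1 p2 z zx zt y yx yt).
- apply (interface_coupling T p2 p1 y yx yt z zx zt); trivial; intros t Ht.
  + apply filterlim_ext with (fun x => - (z x t - y x t)); [intros; ring |].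
    rewrite <- Ropp_0 at 2.
    apply (filterlim_comp _ _ _ _ _ _ _ _ (J t Ht)). apply (filterlim_opp 0).
  + apply filterlim_ext with (fun x => zx x t + yx x t); [intros; ring | auto].
Qed.

(** * Classical solutions as half-waves *)

(** The mixed derivatives cancel by symmetry, because the slope of the
    characteristic and the weight of [d_x z] are the same number [k]. *)
Lemma characteristic_derivative z c k t :
  locally_2d (ex_diff_n z 2) (c + k * t) t ->
  is_derive (fun s => d_t z (c + k * s) s - k * d_x z (c + k * s) s) t
    (d_t (d_t z) (c + k * t) t - k * k * d_x (d_x z) (c + k * t) t).
Proof.
intros Hz.
assert (Hs : d_x (d_t z) (c + k * t) t = d_t (d_x z) (c + k * t) t).
{ apply Schwarz.
  - destruct Hz as [d Hd]. exists d. intros y s Hy Hs.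
    destruct (Hd y s Hy Hs) as (_ & H1 & H2 & H3 & H4).
    repeat split; trivial; [apply H4 | apply H3].
  - apply (locally_2d_singleton _ _ _ Hz).
  - apply (locally_2d_singleton _ _ _ Hz). }
assert (Ha : is_derive (fun s => c + k * s) t k) by (auto_derive; trivial; ring).
assert (Hb : is_derive (fun s : R => s) t 1) by apply @is_derive_id.
assert (Ht1 : locally_2d (ex_diff_n (d_t z) 1) (c + k * t) t).
{ destruct Hz as [d Hd]. exists d. intros y s Hy Hs'. apply (Hd y s Hy Hs'). }
assert (Hx1 : locally_2d (ex_diff_n (d_x z) 1) (c + k * t) t).
{ destruct Hz as [d Hd]. exists d. intros y s Hy Hs'. apply (Hd y s Hy Hs'). }
replace (d_t (d_t z) (c + k * t) t - k * k * d_x (d_x z) (c + k * t) t) with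
  ((d_x (d_t z) (c + k * t) t * k + d_t (d_t z) (c + k * t) t * 1)
   - k * (d_x (d_x z) (c + k * t) t * k + d_t (d_x z) (c + k * t) t * 1)) by (rewrite Hs; ring).
apply @is_derive_minus; [| apply is_derive_scal].
- now apply (is_derive_path (d_t z) (fun s => c + k * s) (fun s => s)).
- now apply (is_derive_path (d_x z) (fun s => c + k * s) (fun s => s)).
Qed.

Lemma strip_open T x t : strip T x t -> locally_2d (strip T) x t.
Proof.
intros H. set (r := Rmin x (Rmin t (T - t))).
assert (Hr : 0 < r) by (unfold strip in H; repeat apply Rmin_pos; lra).
assert (H1 := Rmin_l x (Rmin t (T - t))); assert (H2 := Rmin_r x (Rmin t (T - t))).
assert (H3 := Rmin_l t (T - t)); assert (H4 := Rmin_r t (T - t)). fold r in H1, H2.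
exists (mkposreal r Hr). simpl. intros y s Hy Hs.
apply Rabs_def2 in Hy; apply Rabs_def2 in Hs. unfold strip in *; lra.
Qed.

Lemma extends_to_reflect (k : R) D E T g : extends_to D E g ->
  (forall x t, strip T x t -> D (k * x) t) ->
  (forall x t, strip_closure T x t -> E (k * x) t) ->
  extends_to (strip T) (strip_closure T) (fun x t => g (k * x) t).
Proof.
intros Hg HD HE x t Hxt. destruct (Hg (k * x) t (HE x t Hxt)) as [l Hl]. exists l.
apply (lim2_path _ D g (k * x) t l (fun p : R * R => k * fst p) (fun p : R * R => snd p)); trivial.
- apply (filterlim_filter_le_1 (F := locally (x, t)) (fun p : R * R => k * fst p));
    [apply filter_le_within |].
  apply (continuous_comp (fun p : R * R => fst p) (fun y => k * y)); [apply continuous_fst |].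
  apply (ex_derive_continuous (fun y => k * y)). auto_derive; trivial.
- apply (filterlim_filter_le_1 (F := locally (x, t)) (fun p : R * R => snd p));
    [apply filter_le_within |].
  change (continuous (fun p : R * R => snd p) (x, t)). apply continuous_snd.
- unfold within. apply filter_forall. intros p. apply HD.
Qed.

(** The sign [k] treats the two sides of the interface together; [k = -1]
    reflects the negative half-line. *)
Lemma classical_half_wave (k : R) D E T p v : k = 1 \/ k = -1 ->
  (forall x t, D x t <-> strip T (k * x) t) ->
  (forall x t, strip_closure T x t -> E (k * x) t) ->
  classical_solution D E p v ->
  half_wave T (fun x => p (k * x)) (fun x t => v (k * x) t)
    (fun x t => k * d_x v (k * x) t) (fun x t => d_t v (k * x) t).
Proof.
intros Hk HD HE (Hv & Ev & Ex & Et).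
assert (Hkk : k * k = 1) by (destruct Hk; subst k; ring).
assert (HD' : forall x t, strip T x t -> D (k * x) t).
{ intros x t H. apply HD. now replace (k * (k * x)) with x by (rewrite <- Rmult_assoc, Hkk; ring). }
assert (Hloc : forall x t, D x t -> locally_2d (ex_diff_n v 2) x t).
{ intros x t H. destruct (strip_open T (k * x) t (proj1 (HD x t) H)) as [d Hd]. exists d.
  intros y s Hy Hs. apply Hv. apply HD. apply Hd; trivial.
  rewrite <- Rmult_minus_distr_l, Rabs_mult.
  replace (Rabs k) with 1; [now rewrite Rmult_1_l |].
  destruct Hk; subst k; [rewrite Rabs_R1 | rewrite Rabs_left]; lra. }
split.
- intros x t H. apply (is_derive_comp (fun y => v y t) (fun y => k * y)).
  + apply Derive_correct. apply (Hv _ _ (HD' x t H)).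
  + auto_derive; trivial. ring.
- intros x t H. apply Derive_correct. apply (Hv _ _ (HD' x t H)).
- intros c t H. apply HD' in H. destruct (Hv _ _ H) as [_ Hw]. unfold wave_eq in Hw.
  replace (k * (c - t)) with (k * c + - k * t) in H, Hw |- * by ring.
  apply is_derive_ext with
    (fun s => d_t v (k * c + - k * s) s - - k * d_x v (k * c + - k * s) s).
  { intros s. replace (k * (c - s)) with (k * c + - k * s) by ring. simpl; ring. }
  replace (- (p (k * c + - k * t) * v (k * c + - k * t) t))
    with (d_t (d_t v) (k * c + - k * t) t - - k * - k * d_x (d_x v) (k * c + - k * t) t)
    by (replace (- k * - k) with 1 by (rewrite <- Hkk; ring); lra).
  apply characteristic_derivative; auto.
- intros c t H. apply HD' in H. destruct (Hv _ _ H) as [_ Hw]. unfold wave_eq in Hw.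
  replace (k * (c + t)) with (k * c + k * t) in H, Hw |- * by ring.
  apply is_derive_ext with (fun s => d_t v (k * c + k * s) s - k * d_x v (k * c + k * s) s).
  { intros s. now replace (k * (c + s)) with (k * c + k * s) by ring. }
  replace (- (p (k * c + k * t) * v (k * c + k * t) t))
    with (d_t (d_t v) (k * c + k * t) t - k * k * d_x (d_x v) (k * c + k * t) t)
    by (rewrite Hkk; lra).
  apply characteristic_derivative; auto.
- now apply (extends_to_reflect k D E).
- intros x t H. destruct (extends_to_reflect k D E T _ Ex HD' HE x t H) as [l Hl].
  exists (k * l). apply (filterlim_comp _ _ _ _ (fun y => k * y) _ _ _ Hl).
  apply (ex_derive_continuous (fun y => k * y)). auto_derive; trivial.
- now apply (extends_to_reflect k D E).
Qed.

Lemma half_wave_right T p v :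
  classical_solution (strip T) (strip_closure T) p v -> half_wave T p v (d_x v) (d_t v).
Proof.
intros Hv. apply (classical_half_wave 1 _ _ T) in Hv; [| now left | |].
- replace (fun x => p (1 * x)) with p in Hv
    by (extensionality x; now rewrite !Rmult_1_l).
  replace (fun x t => v (1 * x) t) with v in Hv
    by (extensionality x; extensionality t; now rewrite !Rmult_1_l).
  replace (fun x t => 1 * d_x v (1 * x) t) with (d_x v) in Hv
    by (extensionality x; extensionality t; now rewrite !Rmult_1_l).
  replace (fun x t => d_t v (1 * x) t) with (d_t v) in Hv
    by (extensionality x; extensionality t; now rewrite !Rmult_1_l).
  exact Hv.
- intros x t. now rewrite Rmult_1_l.
- intros x t. now rewrite Rmult_1_l.
Qed.

Lemma half_wave_left T p v :
  classical_solution (fun x t => x < 0 /\ 0 < t < T) (fun x t => x <= 0 /\ 0 <= t < T) p v ->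
  half_wave T (fun x => p (- x)) (fun x t => v (- x) t)
    (fun x t => - d_x v (- x) t) (fun x t => d_t v (- x) t).
Proof.
intros Hv. apply (classical_half_wave (-1) _ _ T) in Hv; [| now right | |].
- assert (E : forall x, -1 * x = - x) by (intros; ring).
  replace (fun x => p (-1 * x)) with (fun x => p (- x)) in Hv
    by (extensionality x; rewrite !E; trivial; ring).
  replace (fun x t => v (-1 * x) t) with (fun x t => v (- x) t) in Hv
    by (extensionality x; extensionality t; rewrite !E; trivial; ring).
  replace (fun x t => -1 * d_x v (-1 * x) t) with (fun x t => - d_x v (- x) t) in Hv
    by (extensionality x; extensionality t; rewrite !E; trivial; ring).
  replace (fun x t => d_t v (-1 * x) t) with (fun x t => d_t v (- x) t) in Hv
    by (extensionality x; extensionality t; rewrite !E; trivial; ring).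
  exact Hv.
- intros x t. unfold strip. split; lra.
- intros x t. unfold strip_closure. lra.
Qed.

(** * The kernels of the decomposition *)

Lemma locally_2d_d_x f g x t : locally_2d (fun y s => f y s = g y s) x t ->
  locally_2d (fun y s => d_x f y s = d_x g y s) x t.
Proof.
intros H. apply locally_2d_locally in H. apply locally_locally in H.
apply locally_2d_locally. revert H. apply filter_imp. intros [y s] H.
apply (locally_2d_locally (fun y s => f y s = g y s)) in H.
apply Derive_ext_loc. apply (locally_2d_1d_const_y (fun y s => f y s = g y s) y s H).
Qed.

Lemma locally_2d_d_t f g x t : locally_2d (fun y s => f y s = g y s) x t ->
  locally_2d (fun y s => d_t f y s = d_t g y s) x t.
Proof.
intros H. apply locally_2d_locally in H. apply locally_locally in H.
apply locally_2d_locally. revert H. apply filter_imp. intros [y s] H.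
apply (locally_2d_locally (fun y s => f y s = g y s)) in H.
apply Derive_ext_loc. apply (locally_2d_1d_const_x (fun y s => f y s = g y s) y s H).
Qed.

Lemma wave_eq_ext_loc p f g x t : locally_2d (fun y s => f y s = g y s) x t ->
  wave_eq p f x t -> wave_eq p g x t.
Proof.
intros H. unfold wave_eq.
rewrite (locally_2d_singleton _ _ _ (locally_2d_d_x _ _ _ _ (locally_2d_d_x _ _ _ _ H))).
rewrite (locally_2d_singleton _ _ _ (locally_2d_d_t _ _ _ _ (locally_2d_d_t _ _ _ _ H))).
now rewrite (locally_2d_singleton _ _ _ H).
Qed.

Lemma triangle_open x t b : 0 < x < t -> t < b ->
  locally_2d (fun y s => 0 < y < s /\ s < b) x t.
Proof.
intros Hx Ht. set (r := Rmin x (Rmin ((t - x) / 2) (b - t))).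
assert (Hr : 0 < r) by (repeat apply Rmin_pos; lra).
assert (H1 := Rmin_l x (Rmin ((t - x) / 2) (b - t))).
assert (H2 := Rmin_r x (Rmin ((t - x) / 2) (b - t))).
assert (H3 := Rmin_l ((t - x) / 2) (b - t)); assert (H4 := Rmin_r ((t - x) / 2) (b - t)).
fold r in H1, H2. exists (mkposreal r Hr). simpl. intros y s Hy Hs.
apply Rabs_def2 in Hy; apply Rabs_def2 in Hs. lra.
Qed.

Lemma locally_interval (a b x : R) : a < x < b -> locally x (fun y => a < y < b).
Proof.
intros H.
assert (Hr : 0 < Rmin (x - a) (b - x)) by (apply Rmin_pos; lra).
exists (mkposreal _ Hr). intros y Hy. apply Rabs_def2 in Hy.
unfold minus, plus, opp in Hy; simpl in Hy.
assert (H1 := Rmin_l (x - a) (b - x)); assert (H2 := Rmin_r (x - a) (b - x)). lra.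
Qed.

(** The wave equation and the diagonal condition are local, so they pass from
    the kernel, known on the triangle only, to its extension to the plane. *)
Lemma outgoing_kernel_of_restriction p kappa (w K : R -> R -> R) :
  (forall x t, ex_diff_n K 2 x t) ->
  (forall x t, 0 <= x <= t -> t <= 2 * PI -> w x t = K x t) ->
  (forall x t, 0 < x < t -> t < 2 * PI -> wave_eq p w x t) ->
  (forall x, 0 < x < 2 * PI -> is_derive (fun y => w y y) x (kappa * (p x / 4))) ->
  outgoing_kernel p kappa K.
Proof.
intros HK E Hw Hd. split; trivial.
- intros x t Hx Ht. apply (wave_eq_ext_loc p w); [| now apply Hw].
  destruct (triangle_open x t (2 * PI) Hx Ht) as [d H]. exists d.
  intros y s Hy Hs. specialize (H y s Hy Hs). apply E; lra.
- intros x Hx. apply (is_derive_ext_loc (fun y => w y y)); [| now apply Hd].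
  generalize (locally_interval 0 (2 * PI) x Hx). apply filter_imp. intros y Hy. apply E; lra.
Qed.

Lemma reflect_C2 a W : (forall x t, ex_diff_n W 2 x t) ->
  (forall x t, ex_diff_n (fun y s => W (a - y) s) 2 x t) /\
  d_x (fun y s => W (a - y) s) = (fun y s => - d_x W (a - y) s) /\
  d_t (fun y s => W (a - y) s) = (fun y s => d_t W (a - y) s) /\
  d_x (d_x (fun y s => W (a - y) s)) = (fun y s => d_x (d_x W) (a - y) s) /\
  d_t (d_t (fun y s => W (a - y) s)) = (fun y s => d_t (d_t W) (a - y) s).
Proof.
intros HW. destruct (ex_diff_n_2_elim W HW) as
  ((Dx & Dt & Dxx & Dxt & Dtx & Dtt) & C & Cx & Ct & Cxx & Cxt & Ctx & Ctt).
assert (R1 : forall g gx : R -> R -> R, (forall x t, is_derive (fun y => g y t) x (gx x t)) ->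
   forall x t, is_derive (fun y => g (a - y) t) x (- gx (a - x) t)).
{ intros g gx Hg x t. replace (- gx (a - x) t) with (-1 * gx (a - x) t) by ring.
  apply (is_derive_comp (fun y => g y t) (fun y => a - y)); [apply Hg |].
  auto_derive; trivial; ring. }
assert (RC : forall g, cont2 g -> cont2 (fun y s => g (a - y) s)).
{ intros g Hg. apply cont2_comp; trivial; [| apply cont2_snd].
  apply cont2_minus; [apply cont2_const | apply cont2_fst]. }
apply (ex_diff_n_2_intro _ _ _ _ (fun y s => - d_t (d_x W) (a - y) s)
  (fun y s => - d_x (d_t W) (a - y) s)); auto using cont2_opp.
- intros x t. replace (d_x (d_x W) (a - x) t) with (- - d_x (d_x W) (a - x) t) by ring.
  apply @is_derive_opp. now apply (R1 (d_x W)).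
- intros x t. apply @is_derive_opp. apply Dxt.
Qed.

Lemma kernel_pair_plus q sigma w0 wp : kernel_pair q sigma w0 wp ->
  exists K,
    (forall x t, 0 <= x <= t -> t <= 2 * PI -> w0 x t = K x t) /\
    (forall p, (forall x, 0 < x < 2 * PI -> p x = q x) -> outgoing_kernel p sigma K).
Proof.
intros ((K & HK & E) & _ & Hw & Hd & _).
assert (E' : forall x t, 0 <= x <= t -> t <= 2 * PI -> w0 x t = K x t).
{ intros x t Hx Ht. apply E; lra. }
exists K. split; trivial.
intros p Hp. apply (outgoing_kernel_of_restriction p sigma w0 K); trivial.
- intros x t Hx Ht. unfold wave_eq. rewrite Hp by lra. now apply Hw.
- intros x Hx. rewrite Hp by trivial. now apply Hd.
Qed.

(** The reflection [x |-> 2 * PI - x] turns the characteristic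
    [t = 2 * PI - x] into the diagonal and changes the sign of the derivative along
    it, so that [kappa = 1] for both components. *)
Lemma kernel_pair_minus q sigma w0 wp : kernel_pair q sigma w0 wp ->
  exists K,
    (forall x t, 0 <= x <= t -> t <= 2 * PI -> wp (2 * PI - x) t = K x t) /\
    (forall p, (forall x, 0 < x < 2 * PI -> p x = q (2 * PI - x)) -> outgoing_kernel p 1 K).
Proof.
intros (_ & (W & HW & E) & _ & _ & Hw & Hd & _).
destruct (reflect_C2 (2 * PI) W HW) as (HK & _ & _ & Exx & Ett).
exists (fun y s => W (2 * PI - y) s). split.
- intros x t Hx Ht. apply E; lra.
- intros p Hp. split; trivial.
  + intros x t Hx Ht. unfold wave_eq. rewrite Exx, Ett, Hp by lra.
    apply (wave_eq_ext_loc q wp W (2 * PI - x) t); [| apply Hw; lra].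
    destruct (triangle_open x t (2 * PI) Hx Ht) as [d H]. exists d.
    intros y s Hy Hs. specialize (H (2 * PI - y) s).
    assert (Hy' : Rabs (2 * PI - y - x) < d).
    { rewrite Rabs_minus_sym. now replace (x - (2 * PI - y)) with (y - (2 * PI - x)) by ring. }
    specialize (H Hy' Hs). apply E; lra.
  + intros x Hx. rewrite Hp by trivial.
    apply (is_derive_ext_loc (fun y => wp (2 * PI - y) (2 * PI - (2 * PI - y)))).
    { generalize (locally_interval 0 (2 * PI) x Hx). apply filter_imp. intros y Hy.
      replace (2 * PI - (2 * PI - y)) with (y : R) by (unfold Rminus; simpl; lra). apply E; simpl; lra. }
    replace (1 * (q (2 * PI - x) / 4)) with (-1 * (- (q (2 * PI - x) / 4))) by ring.
    apply (is_derive_comp (fun y => wp y (2 * PI - y)) (fun y => 2 * PI - y)).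
    * apply Hd; lra.
    * auto_derive; trivial; ring.
Qed.

(** The cut-off of the integral is invisible because the signals vanish at
    negative times. *)
Lemma RInt_fwd_duhamel K1 K2 (w1 w2 f1 f2 : R -> R) x t :
  cont2 K1 -> cont2 K2 -> test_function (2 * PI) f1 -> test_function (2 * PI) f2 ->
  (forall s, x < s < t -> w1 s = K1 x s) -> (forall s, x < s < t -> w2 s = K2 x s) ->
  RInt_fwd (fun s => w1 s * f1 (t - s) + w2 s * f2 (t - s)) x t
  = duhamel K1 f1 x t + duhamel K2 f2 x t.
Proof.
intros C1 C2 Hf1 Hf2 E1 E2. unfold RInt_fwd. destruct (Rle_dec x t) as [Hxt | Hxt].
- rewrite (RInt_ext _ (fun s => plus (K1 x s * f1 (t - s)) (K2 x s * f2 (t - s)))).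
  + apply (RInt_plus (V := R_CompleteNormedModule) (fun s => K1 x s * f1 (t - s))
      (fun s => K2 x s * f2 (t - s)));
    apply ex_RInt_duhamel; trivial; intros r; now apply (test_function_continuous (2 * PI)).
  + intros s Hs. rewrite Rmin_left, Rmax_right in Hs by lra. now rewrite E1, E2.
- rewrite !duhamel_zero; try lra; intros r; now apply (test_function_nonpos (2 * PI)).
Qed.

(** The unspecified values at the three jumps only enlarge the bound. *)
Lemma auxiliary_potential_bounded q qt : C2_segment 0 (2 * PI) q ->
  auxiliary_potential q qt -> exists Q, 0 <= Q /\ forall x, Rabs (qt x) <= Q.
Proof.
intros (q' & Hq' & E) (H1 & H2 & H3). assert (Hpi := PI_RGT_0).
destruct (continuity_ab_maj (fun x => Rabs (q' x)) 0 (2 * PI)) as (m & Hm & _).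
- lra.
- intros x _. apply continuity_pt_filterlim.
  apply (continuous_comp q' Rabs); [apply (Hq' 0%nat x); lia | apply (continuous_abs (q' x))].
- set (M := Rabs (q' m)) in Hm.
  assert (P1 := Rabs_pos (q' m)); fold M in P1.
  assert (P2 := Rabs_pos (qt 0)). assert (P3 := Rabs_pos (qt (2 * PI))).
  assert (P4 := Rabs_pos (qt (- (2 * PI)))).
  exists (M + Rabs (qt 0) + Rabs (qt (2 * PI)) + Rabs (qt (- (2 * PI)))). split; [lra |].
  intros x.
  destruct (Req_dec x 0) as [-> | N0]; [lra |].
  destruct (Req_dec x (2 * PI)) as [-> | N1]; [lra |].
  destruct (Req_dec x (- (2 * PI))) as [-> | N2]; [lra |].
  destruct (Rlt_dec (2 * PI) (Rabs x)) as [Hx | Hx].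
  + rewrite (H3 x Hx), Rabs_R0. lra.
  + apply Rnot_lt_le, Rabs_le_between in Hx.
    destruct (Rlt_dec 0 x) as [Hx0 | Hx0].
    * rewrite H1, E by lra. assert (H := Hm x ltac:(lra)). simpl in H. lra.
    * rewrite H2, E by lra. assert (H := Hm (x + 2 * PI) ltac:(lra)). simpl in H. lra.
Qed.

(** * One-sided traces *)

Lemma Derive_interval g h a b x : (forall y, a < y < b -> g y = h y) -> a < x < b ->
  Derive g x = Derive h x.
Proof.
intros H Hx. apply Derive_ext_loc.
generalize (locally_interval a b x Hx). apply filter_imp. exact H.
Qed.

Lemma right_lim_correct g a l : filterlim g (at_right a) (locally l) -> right_lim g a = l.
Proof. apply (iota_filterlim_locally (V := R_CompleteNormedModule)). Qed.

Lemma left_lim_correct g a l : filterlim g (at_left a) (locally l) -> left_lim g a = l.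
Proof. apply (iota_filterlim_locally (V := R_CompleteNormedModule)). Qed.

Lemma right_traces (g h hx : R -> R) a b : a < b -> (forall x, a < x < b -> g x = h x) ->
  (forall x, is_derive h x (hx x)) -> (forall x, continuous hx x) ->
  right_lim g a = h a /\ right_lim (Derive g) a = hx a.
Proof.
intros Hab E Dh Ch. split; apply right_lim_correct.
- apply (filterlim_ext_loc h).
  + generalize (at_right_interval a b Hab). apply filter_imp. intros x Hx; symmetry; auto.
  + apply at_right_continuous; trivial.
    apply (ex_derive_continuous h). eexists; apply Dh.
- apply (filterlim_ext_loc hx).
  + generalize (at_right_interval a b Hab). apply filter_imp. intros x Hx.
    rewrite (Derive_interval g h a b x E Hx). symmetry; now apply is_derive_unique.
  + now apply at_right_continuous.
Qed.

Lemma left_traces (g h hx : R -> R) a b : b < a -> (forall x, b < x < a -> g x = h x) ->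
  (forall x, is_derive h x (hx x)) -> (forall x, continuous hx x) ->
  left_lim g a = h a /\ left_lim (Derive g) a = hx a.
Proof.
intros Hab E Dh Ch.
assert (Hat : at_left a (fun x => b < x < a)).
{ exists (mkposreal (a - b) ltac:(lra)). intros x Hx Hxa. apply Rabs_def2 in Hx.
  unfold minus, plus, opp in Hx; simpl in Hx. lra. }
split; apply left_lim_correct.
- apply (filterlim_ext_loc h).
  + generalize Hat. apply filter_imp. intros x Hx; symmetry; auto.
  + apply at_left_continuous; trivial.
    apply (ex_derive_continuous h). eexists; apply Dh.
- apply (filterlim_ext_loc hx).
  + generalize Hat. apply filter_imp. intros x Hx.
    rewrite (Derive_interval g h b a x E Hx). symmetry; now apply is_derive_unique.
  + now apply at_left_continuous.
Qed.

(** * Traces and initial data of outgoing waves *)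

Lemma outgoing_classical p kappa K f : outgoing_kernel p kappa K ->
  test_function (2 * PI) f ->
  classical_solution (strip (2 * PI)) (strip_closure (2 * PI)) p (outgoing kappa K f).
Proof.
intros HK Hf.
destruct (outgoing_C2 kappa K f (outgoing_kernel_C2 _ _ _ HK) Hf) as (H2 & _).
destruct (ex_diff_n_2_elim _ H2) as (_ & C & Cx & Ct & _).
assert (HE : forall g, cont2 g -> extends_to (strip (2 * PI)) (strip_closure (2 * PI)) g).
{ intros g Hg x t _. exists (g x t).
  apply (filterlim_filter_le_1 (F := locally (x, t)) (fun p : R * R => g (fst p) (snd p)));
    [apply filter_le_within |].
  now apply cont2_continuous. }
split; [| auto].
intros x t H. split; trivial.
apply outgoing_wave_eq; trivial; [apply HK | |]; apply H.
Qed.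

Lemma half_wave_minus_outgoing p z zx zt k1 K1 f1 k2 K2 f2 :
  half_wave (2 * PI) p z zx zt ->
  outgoing_kernel p k1 K1 -> test_function (2 * PI) f1 ->
  outgoing_kernel p k2 K2 -> test_function (2 * PI) f2 ->
  half_wave (2 * PI) p
    (fun x t => z x t - outgoing k1 K1 f1 x t - outgoing k2 K2 f2 x t)
    (fun x t => zx x t - d_x (outgoing k1 K1 f1) x t - d_x (outgoing k2 K2 f2) x t)
    (fun x t => zt x t - d_t (outgoing k1 K1 f1) x t - d_t (outgoing k2 K2 f2) x t).
Proof.
intros Hz HK1 Hf1 HK2 Hf2.
apply half_wave_minus with (z := fun x t => z x t - outgoing k1 K1 f1 x t)
  (zx := fun x t => zx x t - d_x (outgoing k1 K1 f1) x t)
  (zt := fun x t => zt x t - d_t (outgoing k1 K1 f1) x t).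
- apply half_wave_minus; trivial. now apply half_wave_right, outgoing_classical.
- now apply half_wave_right, outgoing_classical.
Qed.

Lemma filterlim_minus3 {X : Type} (F : (X -> Prop) -> Prop) {FF : Filter F} (f g h : X -> R) a b c :
  filterlim f F (locally a) -> filterlim g F (locally b) -> filterlim h F (locally c) ->
  filterlim (fun x => f x - g x - h x) F (locally (a - b - c)).
Proof.
assert (M : forall (f g : X -> R) a b, filterlim f F (locally a) -> filterlim g F (locally b) ->
   filterlim (fun x => f x - g x) F (locally (a - b))).
{ clear f g h a b c. intros f g a b Hf Hg.
  apply (filterlim_comp_2 _ _ (fun u v : R => u + v) Hf
    (filterlim_comp _ _ _ _ _ _ _ _ Hg (filterlim_opp b))).
  apply (filterlim_plus a (- b)). }
intros Hf Hg Hh. now apply M; [apply M |].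
Qed.

Lemma filterlim_opp_at_left : filterlim (fun x : R => - x) (at_left 0) (at_right 0).
Proof.
intros P [d Hd]. exists d. intros y Hy Hy0. apply Hd; [| lra].
apply Rabs_def2 in Hy. unfold minus, plus, opp in Hy; simpl in Hy.
apply Rabs_def1; unfold minus, plus, opp; simpl; lra.
Qed.

Lemma left_lim_reflect g l : filterlim (fun x => g (- x)) (at_right 0) (locally l) ->
  left_lim g 0 = l.
Proof.
intros H. apply left_lim_correct.
apply filterlim_ext with (fun x => g (- - x)); [intros x; now rewrite Ropp_involutive |].
apply (filterlim_comp _ _ _ _ _ _ _ _ filterlim_opp_at_left H).
Qed.

Lemma side_trace T g t : extends_to (strip T) (strip_closure T) g -> 0 < t < T ->
  exists l, filterlim (fun x => g x t) (at_right 0) (locally l).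
Proof.
intros Hg Ht. destruct (Hg 0 t) as [l Hl]; [unfold strip_closure; lra |]. exists l.
apply (lim2_path (at_right 0) (strip T) g 0 t l (fun x => x) (fun _ => t) Hl).
- apply at_right_id.
- apply filterlim_const.
- generalize (at_right_interval 0 1 Rlt_0_1). apply filter_imp. unfold strip; intros; lra.
Qed.

Lemma initial_trace T g x : extends_to (strip T) (strip_closure T) g -> 0 < x -> 0 < T ->
  filterlim (g x) (at_right 0) (locally (right_lim (g x) 0)).
Proof.
intros Hg Hx HT. destruct (Hg x 0) as [l Hl]; [unfold strip_closure; lra |].
assert (L : filterlim (g x) (at_right 0) (locally l)).
{ apply (lim2_path (at_right 0) (strip T) g x 0 l (fun _ => x) (fun t => t) Hl).
  - apply filterlim_const.
  - apply at_right_id.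
  - generalize (at_right_interval 0 T HT). apply filter_imp. unfold strip; intros; lra. }
now rewrite (right_lim_correct _ _ _ L).
Qed.

Definition wave_pair k1 K1 f1 k2 K2 f2 (x t : R) : R :=
  outgoing k1 K1 f1 x t + outgoing k2 K2 f2 x t.

Definition wave_pair_x k1 K1 f1 k2 K2 f2 (x t : R) : R :=
  d_x (outgoing k1 K1 f1) x t + d_x (outgoing k2 K2 f2) x t.

Section WavePair.
Variables (p : R -> R) (k1 k2 : R) (K1 K2 : R -> R -> R) (f1 f2 : R -> R).
Hypotheses (HK1 : outgoing_kernel p k1 K1) (HK2 : outgoing_kernel p k2 K2).
Hypotheses (Hf1 : test_function (2 * PI) f1) (Hf2 : test_function (2 * PI) f2).
Let W := wave_pair k1 K1 f1 k2 K2 f2.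
Let Wx := wave_pair_x k1 K1 f1 k2 K2 f2.

Lemma outgoing_regular k K f : outgoing_kernel p k K -> test_function (2 * PI) f ->
  (forall x t, is_derive (fun y => outgoing k K f y t) x (d_x (outgoing k K f) x t)) /\
  cont2 (outgoing k K f) /\ cont2 (d_x (outgoing k K f)) /\ cont2 (d_t (outgoing k K f)).
Proof.
intros HK Hf.
destruct (outgoing_C2 k K f (outgoing_kernel_C2 _ _ _ HK) Hf) as (H2 & _).
destruct (ex_diff_n_2_elim _ H2) as ((Dx & _) & C & Cx & Ct & _). auto.
Qed.

Lemma wave_pair_derive x t : is_derive (fun y => W y t) x (Wx x t).
Proof.
apply @is_derive_plus.
- now apply (outgoing_regular k1 K1 f1).
- now apply (outgoing_regular k2 K2 f2).
Qed.

Lemma wave_pair_x_cont2 : cont2 Wx.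
Proof.
apply cont2_plus.
- now apply (outgoing_regular k1 K1 f1).
- now apply (outgoing_regular k2 K2 f2).
Qed.

Lemma wave_pair_reflect_derive a x t :
  is_derive (fun y => W (a - y) t) x (- Wx (a - x) t).
Proof.
replace (- Wx (a - x) t) with (-1 * Wx (a - x) t) by ring.
apply (is_derive_comp (fun y => W y t) (fun y => a - y)); [apply wave_pair_derive |].
auto_derive; trivial; ring.
Qed.

Lemma wave_pair_x_reflect_continuous a x t : continuous (fun y => - Wx (a - y) t) x.
Proof.
apply @continuous_opp.
apply (continuous_comp (fun y => a - y) (fun y => Wx y t)).
- apply continuous_sub_l.
- apply cont2_slice1, wave_pair_x_cont2.
Qed.

Lemma wave_pair_right_traces (g : R -> R) t b : 0 < b ->
  (forall x, 0 < x < b -> g x = W x t) ->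
  right_lim g 0 = W 0 t /\ right_lim (Derive g) 0 = Wx 0 t.
Proof.
intros Hb E. apply (right_traces g (fun x => W x t) (fun x => Wx x t) 0 b); trivial.
- intros x. apply wave_pair_derive.
- intros x. apply cont2_slice1, wave_pair_x_cont2.
Qed.

Lemma wave_pair_left_traces (g : R -> R) t a b : b < a ->
  (forall x, b < x < a -> g x = W (a - x) t) ->
  left_lim g a = W 0 t /\ left_lim (Derive g) a = - Wx 0 t.
Proof.
intros Hb E.
destruct (left_traces g (fun x => W (a - x) t) (fun x => - Wx (a - x) t) a b) as [H1 H2]; trivial.
- intros x. apply wave_pair_reflect_derive.
- intros x. apply wave_pair_x_reflect_continuous.
- now rewrite Rminus_diag in H1, H2.
Qed.

Lemma wave_pair_rest x t : t <= x -> W x t = 0.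
Proof.
intros H. unfold W, wave_pair.
rewrite (proj1 (outgoing_rest k1 K1 f1 (outgoing_kernel_C2 _ _ _ HK1) Hf1 x t H)).
rewrite (proj1 (outgoing_rest k2 K2 f2 (outgoing_kernel_C2 _ _ _ HK2) Hf2 x t H)). ring.
Qed.

Lemma minus_wave_pair_initial (z zt : R -> R -> R) :
  (forall x, 0 < x -> filterlim (z x) (at_right 0) (locally 0)) ->
  (forall x, 0 < x -> filterlim (zt x) (at_right 0) (locally 0)) ->
  forall x, 0 < x ->
  filterlim (fun t => z x t - outgoing k1 K1 f1 x t - outgoing k2 K2 f2 x t)
    (at_right 0) (locally 0) /\
  filterlim (fun t => zt x t - d_t (outgoing k1 K1 f1) x t - d_t (outgoing k2 K2 f2) x t)
    (at_right 0) (locally 0).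
Proof.
intros Iz Izt x Hx.
destruct (outgoing_rest k1 K1 f1 (outgoing_kernel_C2 _ _ _ HK1) Hf1 x 0 ltac:(lra)) as [R1 R1t].
destruct (outgoing_rest k2 K2 f2 (outgoing_kernel_C2 _ _ _ HK2) Hf2 x 0 ltac:(lra)) as [R2 R2t].
destruct (outgoing_regular k1 K1 f1 HK1 Hf1) as (_ & C1 & _ & C1t).
destruct (outgoing_regular k2 K2 f2 HK2 Hf2) as (_ & C2 & _ & C2t).
assert (E0 : 0 - 0 - 0 = 0) by ring.
split; rewrite <- E0 at 2; apply (filterlim_minus3 (at_right 0)); auto;
  apply at_right_continuous; trivial; now apply cont2_slice2.
Qed.
End WavePair.

(** * The two waves and the decomposition *)

Lemma u1_plus_wave_pair w10 w20 K1 K2 f1 f2 x t :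
  cont2 K1 -> cont2 K2 -> test_function (2 * PI) f1 -> test_function (2 * PI) f2 ->
  (forall x t, 0 <= x <= t -> t <= 2 * PI -> w10 x t = K1 x t) ->
  (forall x t, 0 <= x <= t -> t <= 2 * PI -> w20 x t = K2 x t) ->
  0 <= x -> t <= 2 * PI ->
  u1_plus w10 w20 f1 f2 x t = wave_pair (-1) K1 f1 1 K2 f2 x t.
Proof.
intros C1 C2 Hf1 Hf2 E1 E2 Hx Ht. unfold u1_plus, wave_pair, outgoing.
rewrite (RInt_fwd_duhamel K1 K2); trivial.
- field.
- intros s Hs. apply E1; lra.
- intros s Hs. apply E2; lra.
Qed.

Lemma u1_minus_wave_pair w1p w2p K1 K2 f1 f2 x t :
  cont2 K1 -> cont2 K2 -> test_function (2 * PI) f1 -> test_function (2 * PI) f2 ->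
  (forall x t, 0 <= x <= t -> t <= 2 * PI -> w1p (2 * PI - x) t = K1 x t) ->
  (forall x t, 0 <= x <= t -> t <= 2 * PI -> w2p (2 * PI - x) t = K2 x t) ->
  x <= 2 * PI -> t <= 2 * PI ->
  u1_minus w1p w2p f1 f2 x t = wave_pair 1 K1 f1 1 K2 f2 (2 * PI - x) t.
Proof.
intros C1 C2 Hf1 Hf2 E1 E2 Hx Ht. unfold u1_minus, wave_pair, outgoing.
rewrite (RInt_fwd_duhamel K1 K2); trivial.
- replace (t + x - 2 * PI) with (t - (2 * PI - x)) by ring. field.
- intros s Hs. rewrite <- E1 by lra. f_equal; ring.
- intros s Hs. rewrite <- E2 by lra. f_equal; ring.
Qed.

Theorem mainTheorem2
  (q qt : R -> R)
  (Hq : C2_segment 0 (2 * PI) q)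
  (Hqt : auxiliary_potential q qt)
  (w10 w20 w1p w2p : R -> R -> R)
  (Hw : decomposition_kernels q w10 w20 w1p w2p)
  (f1 f2 : R -> R)
  (Hf1 : test_function (2 * PI) f1)
  (Hf2 : test_function (2 * PI) f2)
  (u v : R -> R -> R)
  (Hu : periodic_solution q f1 f2 u)
  (Hv : line_solution qt f1 f2 v) :
  (forall t : R, 0 < t < 2 * PI ->
     (forall x : R, 0 < x < 2 * PI ->
        v x t = u1_plus w10 w20 f1 f2 x t) /\
     (forall x : R, - (2 * PI) < x < 0 ->
        v x t = u1_minus w1p w2p f1 f2 (x + 2 * PI) t)) /\
  (forall t : R, 0 < t < 2 * PI ->
     periodic_response u t = line_response v t).
Proof.
assert (Hpi := PI_RGT_0).
destruct Hw as (Hk1 & Hk2 & Hdec).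
destruct (kernel_pair_plus _ _ _ _ Hk1) as (K1 & E1 & HK1).
destruct (kernel_pair_plus _ _ _ _ Hk2) as (K2 & E2 & HK2).
destruct (kernel_pair_minus _ _ _ _ Hk1) as (L1 & F1 & HL1).
destruct (kernel_pair_minus _ _ _ _ Hk2) as (L2 & F2 & HL2).
assert (Hqt0 := Hqt). destruct Hqt0 as (Q1 & Q2 & _).
destruct (auxiliary_potential_bounded q qt Hq Hqt) as (Q & HQ & BQ).
assert (Hqt' : forall x, 0 < x < 2 * PI -> qt (- x) = q (2 * PI - x)).
{ intros x Hx. rewrite Q2 by lra. f_equal; ring. }
specialize (HK1 qt Q1). specialize (HK2 qt Q1).
specialize (HL1 (fun x => qt (- x)) Hqt'). specialize (HL2 (fun x => qt (- x)) Hqt').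
assert (CK1 : cont2 K1) by apply (ex_diff_n_2_elim K1 (outgoing_kernel_C2 _ _ _ HK1)).
assert (CK2 : cont2 K2) by apply (ex_diff_n_2_elim K2 (outgoing_kernel_C2 _ _ _ HK2)).
assert (CL1 : cont2 L1) by apply (ex_diff_n_2_elim L1 (outgoing_kernel_C2 _ _ _ HL1)).
assert (CL2 : cont2 L2) by apply (ex_diff_n_2_elim L2 (outgoing_kernel_C2 _ _ _ HL2)).
set (P := wave_pair (-1) K1 f1 1 K2 f2).
set (M := wave_pair 1 L1 f1 1 L2 f2).
set (Px := wave_pair_x (-1) K1 f1 1 K2 f2).
set (Mx := wave_pair_x 1 L1 f1 1 L2 f2).
assert (EP : forall x t, 0 <= x -> t <= 2 * PI -> u1_plus w10 w20 f1 f2 x t = P x t).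
{ intros x t Hx Ht. now apply u1_plus_wave_pair. }
assert (EM : forall x t, x <= 2 * PI -> t <= 2 * PI ->
   u1_minus w1p w2p f1 f2 x t = M (2 * PI - x) t).
{ intros x t Hx Ht. now apply u1_minus_wave_pair. }
(* Up to time 2 PI, the wave sent out by one end has not reached the other
   end, so near each end u consists of one of the two waves only. *)
assert (TuP : forall t, 0 < t < 2 * PI ->
  right_lim (fun x => u x t) 0 = P 0 t /\ right_lim (fun x => d_x u x t) 0 = Px 0 t).
{ intros t Ht.
  apply (wave_pair_right_traces qt (-1) 1 K1 K2 f1 f2 HK1 HK2 Hf1 Hf2 (fun x => u x t) t (2 * PI - t)); [lra |].
  intros x Hx. rewrite (Hdec f1 f2 u Hf1 Hf2 Hu), EP, EM by lra.
  unfold M. rewrite (wave_pair_rest (fun x => qt (- x))) by (trivial; lra). apply Rplus_0_r. }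
assert (TuM : forall t, 0 < t < 2 * PI ->
  left_lim (fun x => u x t) (2 * PI) = M 0 t /\ left_lim (fun x => d_x u x t) (2 * PI) = - Mx 0 t).
{ intros t Ht.
  apply (wave_pair_left_traces (fun x => qt (- x)) 1 1 L1 L2 f1 f2 HL1 HL2 Hf1 Hf2 (fun x => u x t) t (2 * PI) t); [lra |].
  intros x Hx. rewrite (Hdec f1 f2 u Hf1 Hf2 Hu), EP, EM by lra.
  unfold P. rewrite (wave_pair_rest qt) by (trivial; lra). apply Rplus_0_l. }
(* The jumps of P and M across the interface are the jumps of u, by TuP and
   TuM; by hypothesis these are the jumps of v. *)
assert (HZ : forall x t, strip (2 * PI) x t ->
   v x t - outgoing (-1) K1 f1 x t - outgoing 1 K2 f2 x t = 0 /\
   v (- x) t - outgoing 1 L1 f1 x t - outgoing 1 L2 f2 x t = 0).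
{ destruct Hv as (Hvr & Hvl & Hvi & Hvj).
  apply half_wave_right in Hvr. apply half_wave_left in Hvl.
  assert (HT : 0 < 2 * PI) by lra.
  assert (Ir : forall x, 0 < x -> filterlim (v x) (at_right 0) (locally 0) /\
     filterlim (d_t v x) (at_right 0) (locally 0)).
  { intros x Hx. destruct (Hvi x) as [I1 I2]; [lra |].
    split; [rewrite <- I1 at 2 | rewrite <- I2 at 2]; apply (initial_trace (2 * PI)); trivial; apply Hvr. }
  assert (Il : forall x, 0 < x -> filterlim (v (- x)) (at_right 0) (locally 0) /\
     filterlim (d_t v (- x)) (at_right 0) (locally 0)).
  { intros x Hx. destruct (Hvi (- x)) as [I1 I2]; [lra |].
    split; [rewrite <- I1 at 2 | rewrite <- I2 at 2].
    - apply (initial_trace (2 * PI) (fun x t => v (- x) t)); trivial; apply Hvl.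
    - apply (initial_trace (2 * PI) (fun x t => d_t v (- x) t)); trivial; apply Hvl. }
  assert (Sr := minus_wave_pair_initial qt (-1) 1 K1 K2 f1 f2 HK1 HK2 Hf1 Hf2 v (d_t v)
    (fun x Hx => proj1 (Ir x Hx)) (fun x Hx => proj2 (Ir x Hx))).
  assert (Sl := minus_wave_pair_initial (fun x => qt (- x)) 1 1 L1 L2 f1 f2 HL1 HL2 Hf1 Hf2
    (fun x t => v (- x) t) (fun x t => d_t v (- x) t)
    (fun x Hx => proj1 (Il x Hx)) (fun x Hx => proj2 (Il x Hx))).
  apply (transmission_uniqueness (2 * PI) Q qt (fun x => qt (- x)) _ _ _ _ _ _ HQ HT
    (fun x _ => BQ x) (fun x _ => BQ (- x))
    (half_wave_minus_outgoing _ _ _ _ _ _ _ _ _ _ Hvr HK1 Hf1 HK2 Hf2)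
    (half_wave_minus_outgoing _ _ _ _ _ _ _ _ _ _ Hvl HL1 Hf1 HL2 Hf2)).
  - intros x Hx. apply (Sr x Hx).
  - intros x Hx. apply (Sr x Hx).
  - intros x Hx. apply (Sl x Hx).
  - intros x Hx. apply (Sl x Hx).
  - intros t Ht.
    destruct (side_trace _ _ t (half_wave_ext _ _ _ _ _ Hvr) Ht) as [a Ha].
    destruct (side_trace _ _ t (half_wave_ext _ _ _ _ _ Hvl) Ht) as [b Hb].
    destruct (Hvj t Ht) as [J _].
    rewrite (right_lim_correct _ _ _ Ha), (left_lim_reflect (fun x => v x t) _ Hb) in J.
    destruct Hu as (_ & _ & Huj). destruct (Huj t) as [Ju _]; [lra |].
    rewrite (proj1 (TuP t Ht)), (proj1 (TuM t Ht)) in Ju.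
    assert (LP : filterlim (fun x => P x t) (at_right 0) (locally (P 0 t))).
    { apply at_right_continuous; trivial. apply (ex_derive_continuous (fun x => P x t)).
      eexists. now apply (wave_pair_derive qt). }
    assert (LM : filterlim (fun x => M x t) (at_right 0) (locally (M 0 t))).
    { apply at_right_continuous; trivial. apply (ex_derive_continuous (fun x => M x t)).
      eexists. now apply (wave_pair_derive (fun x => qt (- x))). }
    assert (L := filterlim_minus3 (at_right 0) _ _ _ _ _ _ Ha Hb
      (filterlim_minus3 (at_right 0) _ _ _ _ _ _ LP LM (filterlim_const 0))).
    replace (a - b - (P 0 t - M 0 t - 0)) with 0 in L by lra.
    apply filterlim_ext with (2 := L). intros x. unfold P, M, wave_pair. ring.
  - intros t Ht.
    destruct (side_trace _ _ t (half_wave_ext_x _ _ _ _ _ Hvr) Ht) as [a Ha].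
    destruct (side_trace _ _ t (half_wave_ext_x _ _ _ _ _ Hvl) Ht) as [b Hb].
    destruct (Hvj t Ht) as [_ J].
    assert (Hb' : filterlim (fun x => d_x v (- x) t) (at_right 0) (locally (- b))).
    { apply filterlim_ext with (fun x => - - d_x v (- x) t); [intros; ring |].
      apply (filterlim_comp _ _ _ _ _ _ _ _ Hb). apply (filterlim_opp b). }
    rewrite (right_lim_correct _ _ _ Ha), (left_lim_reflect (fun x => d_x v x t) _ Hb') in J.
    destruct Hu as (_ & _ & Huj). destruct (Huj t) as [_ Ju]; [lra |].
    rewrite (proj2 (TuP t Ht)), (proj2 (TuM t Ht)) in Ju.
    assert (LP : filterlim (fun x => Px x t) (at_right 0) (locally (Px 0 t))).
    { apply at_right_continuous; trivial. apply cont2_slice1. now apply (wave_pair_x_cont2 qt). }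
    assert (LM : filterlim (fun x => Mx x t) (at_right 0) (locally (Mx 0 t))).
    { apply at_right_continuous; trivial. apply cont2_slice1.
      now apply (wave_pair_x_cont2 (fun x => qt (- x))). }
    assert (L := filterlim_minus3 (at_right 0) _ _ _ _ _ _ Ha LP
      (filterlim_minus3 (at_right 0) _ _ _ _ _ _ LM Hb (filterlim_const 0))).
    replace (a - Px 0 t - (Mx 0 t - b - 0)) with 0 in L by lra.
    apply filterlim_ext with (2 := L). intros x. unfold Px, Mx, wave_pair_x. ring. }
assert (VP : forall x t, 0 < x -> 0 < t < 2 * PI -> v x t = P x t).
{ intros x t Hx Ht. unfold P, wave_pair. destruct (HZ x t) as [H _]; [now split |]. lra. }
assert (VM : forall x t, x < 0 -> 0 < t < 2 * PI -> v x t = M (0 - x) t).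
{ intros x t Hx Ht. unfold M, wave_pair. replace (0 - x) with (- x) by ring.
  destruct (HZ (- x) t) as [_ H]; [split; lra |].
  rewrite Ropp_involutive in H. lra. }
split; intros t Ht.
- split; intros x Hx.
  + rewrite EP by lra. apply VP; lra.
  + rewrite EM by lra. replace (2 * PI - (x + 2 * PI)) with (0 - x) by ring. apply VM; lra.
- destruct (wave_pair_right_traces qt (-1) 1 K1 K2 f1 f2 HK1 HK2 Hf1 Hf2 (fun x => v x t) t 1)
    as [V1 V2]; [lra | intros x Hx; apply VP; lra |].
  destruct (wave_pair_left_traces (fun x => qt (- x)) 1 1 L1 L2 f1 f2 HL1 HL2 Hf1 Hf2
    (fun x => v x t) t 0 (-1)) as [V3 V4]; [lra | intros x Hx; apply VM; lra |].
  destruct (TuP t Ht) as [U1 U2]. destruct (TuM t Ht) as [U3 U4].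
  unfold periodic_response, line_response.
  rewrite U1, U2, U3, U4, V1, V3.
  change (right_lim (fun x => d_x v x t) 0 = Px 0 t) in V2.
  change (left_lim (fun x => d_x v x t) 0 = - Mx 0 t) in V4.
  now rewrite V2, V4.
Qed.
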